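(* Let $P$ be a nonempty set, $X$ and $Y$ Banach spaces, $F:P\times X\rightrightarrows Y$ a set-valued mapping such that $\operatorname{gph}F_p$ is closed for all $p\in P$, $\bar x\in X$, $\bar y\in Y$, $\alpha>0$, $\delta\in]0,+\infty]$ and $\mu\in]0,+\infty]$. The mapping $F$ is $\alpha$-subregular in $x$ uniformly in $p$ over $P$ at $(\bar x,\bar y)$ with $\delta$ and $\mu$ if, for some $\eta\in]0,+\infty]$, and all $p\in P$, $x\in B_{\delta+\mu}(\bar x)$ and $y\in Y$ satisfying $x\notin F_p^{-1}(\bar y)$ and $y\in F(p,x)\cap B_{\alpha\mu}(\bar y)$, one of the following conditions is satisfied: (i) with $D^*:=D^*_C$ (Clarke coderivative), for all $y^*\in Y^*$ satisfying $\|y^*\|=1$ and $\langle y^*,y-\bar y\rangle=\|y-\bar y\|$, it holds $$d\big(0,D^*F_p(x,y)(B_\eta(y^* ))\big)\ge\alpha;\qquad(\ast)$$ (ii) $X$ and $Y$ are Asplund, and there exists a $\tau\in]0,1[$ such that inequality $(\ast)$ holds with $D^*:=D^*_F$ (Fréchet coderivative) for all $y^*\in Y^*$ satisfying $\|y^*\|=1$ and $\langle y^*,y-\bar y\rangle>\tau\|y-\bar y\|$.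
   Context: $B_r(z)$ denotes the open ball with center $z$ and radius $r\in]0,+\infty]$ (also in dual spaces; $B_{+\infty}(z)$ is the whole space). $d(z,\emptyset)=+\infty$. Products of normed spaces carry the maximum norm. For $p\in P$, $F_p:=F(p,\cdot)$, $\operatorname{gph}F_p=\{(x,y)\mid y\in F(p,x)\}$, $F_p^{-1}(y)=\{x\in X\mid y\in F(p,x)\}$. Definition. $F$ is $\alpha$-subregular in $x$ uniformly in $p$ over $P$ at $(\bar x,\bar y)$ with $\delta$ and $\mu$ if $\alpha\, d(x,F_p^{-1}(\bar y))\le d(\bar y,F(p,x))$ for all $p\in P$ and $x\in B_\delta(\bar x)$ with $d(\bar y,F(p,x))<\alpha\mu$. Fréchet normal cone to $\Omega$ at $\bar z\in\Omega$: $N^F_\Omega(\bar z)=\{z^*\mid\limsup_{\Omega\ni z\to\bar z,\,z\ne\bar z}\frac{\langle z^*,z-\bar z\rangle}{\|z-\bar z\|}\le0\}$. Clarke tangent cone $T^C_\Omega(\bar z)$: the set of $w$ such that for all sequences $z_k\to\bar z$ in $\Omega$ and $t_k\downarrow0$ there exist $w_k\to w$ with $z_k+t_kw_k\in\Omega$ for all $k$. Clarke normal cone: $N^C_\Omega(\bar z)=\{z^*\mid\langle z^*,w\rangle\le0\ \forall w\in T^C_\Omega(\bar z)\}$. Coderivatives of $\Phi:X\rightrightarrows Y$ at $(x,y)\in\operatorname{gph}\Phi$: $D^*\Phi(x,y)(y^* )=\{x^*\in X^*\mid(x^*,-y^* )\in N_{\operatorname{gph}\Phi}(x,y)\}$,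 with $N=N^C$ for $D^*_C$ and $N=N^F$ for $D^*_F$; for a set $V\subset Y^*$, $D^*\Phi(x,y)(V)=\bigcup_{v^*\in V}D^*\Phi(x,y)(v^* )$. A Banach space is Asplund if the dual of each of its separable subspaces is separable.
   Formalization: For each p, one of (i), (ii) must hold for all the stated x and y, in case (ii) with a single τ; if the choice between (i) and (ii), or τ, may vary with (x,y), the claim fails (e.g. X=ℝ, Y=ℝ² with the maximum norm and F constant, equal to a union of three rays from (1,1)). *)

(* Defs.v *)
From HB Require Import structures.
From mathcomp Require Import all_boot all_order all_algebra.
From mathcomp Require Import all_classical all_reals all_analysis.

Set Implicit Arguments.
Unset Strict Implicit.
Unset Printing Implicit Defensive.

Import Order.TTheory GRing.Theory Num.Theory.
Import numFieldNormedType.Exports.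

Local Open Scope classical_set_scope.
Local Open Scope ring_scope.

Section NormedSpaces.
Context {R : realType}.
Implicit Type V : normedModType R.

Definition eball V (z : V) (r : \bar R) : set V :=
  [set u | (`|u - z|%:E < r)%E].

(* Distances to sets are the library's [edist_inf]; it is the infimum of the
   norms of the differences, with value +oo on the empty set. *)
Lemma edist_infE V (A : set V) (z : V) :
  edist_inf A z = ereal_inf [set `|z - a|%:E | a in A].
Proof.
rewrite /edist_inf; congr ereal_inf; apply: eq_imagel => a _.
have bE (r : R) : ball z r a = (`|z - a| < r) :> Prop by rewrite -ball_normE.
have le_edist e : 0 < e -> (edist (z, a) <= (`|z - a| + e)%:E)%E.
  by move=> e0; apply: edist_fin; rewrite ?ltr_wpDl//= bE ltrDl.
have edist_fin_num : edist (z, a) \is a fin_num.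
  rewrite ge0_fin_numE ?edist_ge0//.
  exact: le_lt_trans (le_edist 1 ltr01) (ltry _).
apply/eqP; rewrite eq_le; apply/andP; split.
  by apply/lee_addgt0Pr => e e0; rewrite -EFinD le_edist.
apply/lee_addgt0Pr => e e0; rewrite -(fineK edist_fin_num) -EFinD lee_fin.
have : ball z (fine (edist (z, a)) + e) a.
  apply: (@edist_lt_ball _ _ _ (z, a)).
  by rewrite EFinD fineK// lteDl// lte_fin.
by rewrite bE => /ltW.
Qed.

(* The elements of the topological dual of V, as functions V -> R. *)
Definition dual V : set (V -> R) :=
  [set f : V -> R | linear (f : V -> R^o) /\ continuous f].

Definition dual_norm V (f : V -> R) : \bar R :=
  ereal_sup [set `|f v|%:E | v in [set v : V | `|v| <= 1]].

Definition dual_ball V (f : V -> R) (r : \bar R) : set (V -> R) :=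
  [set g | dual g /\ (dual_norm (g \- f)%R < r)%E].

Definition dual_dist0 V (S : set (V -> R)) : \bar R :=
  ereal_inf [set dual_norm f | f in S].

Definition frechet_normal V (Omega : set V) (zbar : V) : set (V -> R) :=
  [set f | dual f /\
    (limf_esup (fun z => (f (z - zbar) / `|z - zbar|)%:E)
       (within Omega zbar^') <= 0)%E].

Definition clarke_tangent V (Omega : set V) (zbar : V) : set V :=
  [set w | forall (z : nat -> V) (t : nat -> R),
    (forall k, Omega (z k)) -> z @ \oo --> zbar ->
    (forall k, 0 < t k) -> t @ \oo --> 0 ->
    exists2 w' : nat -> V, w' @ \oo --> w &
      forall k, Omega (z k + t k *: w' k)].

Definition clarke_normal V (Omega : set V) (zbar : V) : set (V -> R) :=
  [set f | dual f /\ forall w, clarke_tangent Omega zbar w -> f w <= 0].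

(* Elements of the dual of a linear subspace L of V are represented by
   functions on V whose values outside L are irrelevant: only their values on
   L enter in [subspace_dual] and in [subspace_dual_norm]. *)
Definition linear_subspace V (L : set V) : Prop :=
  L 0 /\ forall (a : R) (u v : V), L u -> L v -> L (a *: u + v).

Definition separable_subset V (L : set V) : Prop :=
  exists D : set V, [/\ countable D, D `<=` L & L `<=` closure D].

Definition subspace_dual V (L : set V) : set (V -> R) :=
  [set f : V -> R | (forall (a : R) (u v : V), L u -> L v ->
              f (a *: u + v) = a * f u + f v) /\
           {within L, continuous f}].

Definition subspace_dual_norm V (L : set V) (f : V -> R) : \bar R :=
  ereal_sup [set `|f v|%:E | v in [set v | L v /\ `|v| <= 1]].

Definition separable_subspace_dual V (L : set V) : Prop :=
  exists D : set (V -> R), [/\ countable D, D `<=` subspace_dual L &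
    forall f, subspace_dual L f -> forall e : R, 0 < e ->
      exists2 g, D g & (subspace_dual_norm L (f \- g)%R < e%:E)%E].

Definition asplund (V : completeNormedModType R) : Prop :=
  forall L : set V, linear_subspace L -> separable_subset L ->
    separable_subspace_dual L.

End NormedSpaces.

Section SetValuedMappings.
Context {R : realType} {X Y : normedModType R}.

Definition gph (Phi : X -> set Y) : set (X * Y) := [set z | Phi z.1 z.2].

Definition preimg (Phi : X -> set Y) (y : Y) : set X := [set x | Phi x y].

(* [N] is the normal cone (Clarke or Frechet).  A pair of functionals (f, g) is
   identified with (u, v) |-> f u + g v on X * Y, here with g := - ystar. *)
Definition coderivative
    (N : set (X * Y) -> X * Y -> set (X * Y -> R))
    (Phi : X -> set Y) (x : X) (y : Y) (ystar : Y -> R) : set (X -> R) :=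
  [set xstar | dual xstar /\
     N (gph Phi) (x, y) (fun z => xstar z.1 - ystar z.2)].

Definition coderivative_image
    (N : set (X * Y) -> X * Y -> set (X * Y -> R))
    (Phi : X -> set Y) (x : X) (y : Y) (A : set (Y -> R)) : set (X -> R) :=
  \bigcup_(v in A) coderivative N Phi x y v.

Definition uniformly_subregular (P : Type) (F : P -> X -> set Y)
    (alpha : R) (xbar : X) (ybar : Y) (delta mu : \bar R) : Prop :=
  forall (p : P) (x : X), eball xbar delta x ->
    (edist_inf (F p x) ybar < alpha%:E * mu)%E ->
    (alpha%:E * edist_inf (preimg (F p) ybar) x <= edist_inf (F p x) ybar)%E.

End SetValuedMappings.

(* Main.v *)
Require Import Defs.
From HB Require Import structures.
From mathcomp Require Import all_boot all_order all_algebra.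
From mathcomp Require Import all_classical all_reals all_analysis.
From mathcomp Require Import lra ring.

Set Implicit Arguments.
Unset Strict Implicit.
Unset Printing Implicit Defensive.

Import Order.TTheory GRing.Theory Num.Theory.
Import numFieldNormedType.Exports.

Local Open Scope classical_set_scope.
Local Open Scope ring_scope.

(* If subregularity fails at x, Ekeland's principle on the graph of F_p, applied
   to (u, v) |-> |v - ybar| with the norm |u| + g |v|, yields a graph point, away
   from the solution set, at which |v - ybar| + a (|u - x| + g |v - y|) is
   minimal for some a < alpha.  Dualizing this minimality contradicts the
   coderivative estimate.

   In the Clarke case this is the Mazur-Orlicz form of the Hahn-Banach theorem,
   applied to the Clarke tangent cone.

   In the Asplund case a separable reduction comes first.  Given bounds and
   moduli, a Frechet normal at z exists unless some finite system of graph points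
   is contradictory; such systems persist near z, so a separable closed subspace
   LX * LY can be closed under them.  The duals of LX and LY are separable, hence
   the norm is a uniform limit of functions max_(|f| <= 1) (f x - s h f) that are
   Frechet superdifferentiable along the subspace, where h is the sum over n of
   2^-n dist(f, e_n)^2 for a dense sequence (e_n) of the dual unit ball.
   A smooth variational principle with these functions as perturbations gives a
   point of LX * LY carrying approximate normals along the subspace, which exclude
   contradictory systems there, and so in the whole space. *)

(** * Sublinear functionals, Hahn-Banach and Mazur-Orlicz *)

Section HahnBanach.
Context {R : realType} {V : lmodType R}.
Implicit Types (q S : V -> R) (C : set (V * R)).

Definition sublinear q : Prop :=
  (forall u v, q (u + v) <= q u + q v) /\
  (forall (t : R) v, 0 <= t -> q (t *: v) = t * q v).

Lemma sublinear0 {q} : sublinear q -> q 0 = 0.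
Proof. by case=> _ hZ; rewrite -[in LHS](scale0r (0 : V)) hZ// mul0r. Qed.

Lemma sublinearN_le {q} (v : V) : sublinear q -> - q (- v) <= q v.
Proof.
move=> hq; have := hq.1 v (- v); rewrite subrr (sublinear0 hq); lra.
Qed.

Definition convex_cone C : Prop :=
  [/\ C (0, 0), forall c d, C c -> C d -> C (c + d) &
      forall (t : R) c, 0 <= t -> C c -> C (t *: c.1, t * c.2)].

(** A pair c in C encodes the constraint [f c.1 <= c.2] on a linear f. Under the hypotheses below, a
    linear f lies under [cone_inf C S] exactly when it lies under S and meets every constraint. *)
Definition cone_inf C S (w : V) : R := inf [set S (w - c.1) + c.2 | c in C].

Section ConeInf.
Variables (C : set (V * R)) (S : V -> R).
Hypotheses (hC : convex_cone C) (hS : sublinear S).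
Hypothesis hCS : forall c, C c -> 0 <= S (- c.1) + c.2.

(** The compatibility [hCS] bounds these sets from below, so [inf] is a true infimum. *)
Let lower w : lbound [set S (w - c.1) + c.2 | c in C] (- S (- w)).
Proof.
move=> _ [c Cc <-]; have := hCS Cc.
have := hS.1 (w - c.1) (- w); rewrite addrAC subrr add0r; lra.
Qed.

Lemma cone_inf_le w c : C c -> cone_inf C S w <= S (w - c.1) + c.2.
Proof. by move=> Cc; apply: ge_inf; [exists (- S (- w)); exact: lower|exists c]. Qed.

Lemma cone_inf_ge w r :
  (forall c, C c -> r <= S (w - c.1) + c.2) -> r <= cone_inf C S w.
Proof.
move=> h; apply: lb_le_inf; last by move=> _ [c Cc <-]; exact: h.
by exists (S (w - 0) + 0), (0, 0) => //; case: hC.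
Qed.

Lemma cone_inf_minorant w : cone_inf C S w <= S w.
Proof.
by case: hC => C0 _ _; have := cone_inf_le w C0; rewrite /= subr0 addr0.
Qed.

Lemma cone_inf_constraint c : C c -> cone_inf C S c.1 <= c.2.
Proof. by move=> /(cone_inf_le c.1); rewrite subrr (sublinear0 hS) add0r. Qed.

(** Subadditivity comes from adding constraints, homogeneity from scaling them. For t > 0 one
    inequality is enough, since it also applies to [t^-1]. *)
Lemma sublinear_cone_inf : sublinear (cone_inf C S).
Proof.
have hZ (t : R) v : 0 < t -> cone_inf C S (t *: v) <= t * cone_inf C S v.
  move=> t0; rewrite -ler_pdivrMl//; apply: cone_inf_ge => c Cc.
  rewrite ler_pdivrMl// mulrDr -(hS.2 _ _ (ltW t0)) scalerBr.
  have /(cone_inf_le (t *: v))// : C (t *: c.1, t * c.2).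
    by case: hC => _ _; apply => //; exact: ltW.
split=> [u v|t v].
  rewrite -lerBlDr; apply: cone_inf_ge => c Cc.
  rewrite lerBlDl -lerBlDr; apply: cone_inf_ge => d Cd; rewrite lerBlDr.
  have /(cone_inf_le (u + v)) : C (c + d) by case: hC => _ h _; exact: h.
  move=> /le_trans; apply => /=; have := hS.1 (u - c.1) (v - d.1).
  rewrite addrACA -opprD; lra.
rewrite le_eqVlt => /predU1P[<-|t0].
  rewrite scale0r mul0r; apply/le_anti; case: (hC) => C0 _ _.
  have := @cone_inf_constraint _ C0 => /= ->.
  by apply: cone_inf_ge => c Cc; rewrite sub0r hCS.
apply/le_anti; rewrite hZ//= -ler_pdivlMl//.
have := hZ t^-1 (t *: v); rewrite invr_gt0 => /(_ t0).
by rewrite scalerA mulVf ?gt_eqF// scale1r.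
Qed.

End ConeInf.

(** The pointwise infimum works: elements that are nearly optimal at u and at v are comparable, so
    the smaller one serves both points. *)
Lemma sublinear_chain_inf S (A : set (V -> R)) :
  A !=set0 -> (forall q, A q -> sublinear q /\ forall v, q v <= S v) ->
  (forall q1 q2, A q1 -> A q2 ->
     (forall v, q1 v <= q2 v) \/ (forall v, q2 v <= q1 v)) ->
  exists q, [/\ sublinear q, forall v, q v <= S v &
             forall q', A q' -> forall v, q v <= q' v].
Proof.
move=> [q0 Aq0] hA tot; pose m v := inf [set q v | q in A].
have lower q v : A q -> - S (- v) <= q v.
  move=> Aq; apply: (le_trans _ (sublinearN_le v (hA _ Aq).1)).
  by rewrite lerN2 (hA _ Aq).2.
have mle q v : A q -> m v <= q v.
  move=> Aq; apply: ge_inf; last by exists q.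
  by exists (- S (- v)) => _ [q' Aq' <-]; exact: lower.
have mge r v : (forall q, A q -> r <= q v) -> r <= m v.
  move=> h; apply: lb_le_inf; last by move=> _ [q Aq <-]; exact: h.
  by exists (q0 v), q0.
have mZ (t : R) v : 0 < t -> m (t *: v) <= t * m v.
  move=> t0; rewrite -ler_pdivrMl//; apply/mge => q Aq.
  by rewrite ler_pdivrMl// -((hA _ Aq).1.2 _ _ (ltW t0)) mle.
exists m; split=> [|v|q Aq v]; last 2 first.
- by apply: le_trans (mle _ v Aq0) _; exact: (hA _ Aq0).2.
- exact: mle.
split=> [u v|t v].
  rewrite -lerBlDr; apply/mge => q Aq.
  rewrite lerBlDl -lerBlDr; apply/mge => q' Aq'; rewrite lerBlDr.
  case: (tot _ _ Aq Aq') => h.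
    apply: le_trans (mle q _ Aq) _; apply: le_trans ((hA _ Aq).1.1 u v) _.
    by rewrite addrC lerD2r h.
  apply: le_trans (mle q' _ Aq') _; apply: le_trans ((hA _ Aq').1.1 u v) _.
  by rewrite addrC lerD2l h.
rewrite le_eqVlt => /predU1P[<-|t0].
  rewrite scale0r mul0r; apply/le_anti.
  rewrite -{1}(sublinear0 (hA _ Aq0).1) mle//=; apply/mge => q Aq.
  by rewrite (sublinear0 (hA _ Aq).1).
apply/le_anti; rewrite mZ//= -ler_pdivlMl//.
have := mZ t^-1 (t *: v); rewrite invr_gt0 => /(_ t0).
by rewrite scalerA mulVf ?gt_eqF// scale1r.
Qed.

Lemma exists_minimal_sublinear S : sublinear S ->
  exists q, [/\ sublinear q, forall v, q v <= S v &
    forall q', sublinear q' -> (forall v, q' v <= q v) -> q' = q].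
Proof.
move=> hS; pose T := {q : V -> R | sublinear q /\ forall v, q v <= S v}.
(* The order is reversed, so a maximal element for Zorn is a minimal functional. *)
pose r (s t : T) := `[<forall v, sval t v <= sval s v>].
have [|||A tot|[q [hq qS]] qmin] := @Zorn T r.
- by move=> s; apply/asboolP.
- move=> a b c /asboolP ab /asboolP bc; apply/asboolP => v.
  exact: le_trans (bc v) (ab v).
- move=> [s hs] [t ht] /asboolP /= st /asboolP /= ts; apply: eq_exist.
  by apply/funext => v; apply/le_anti; rewrite st ts.
- have [->|/set0P[s0 As0]] := eqVneq A set0.
    by exists (exist _ S (conj hS (fun=> lexx _))).
  have [|_ [s As <-]|_ _ [s As <-] [t At <-]|m [hm mS mA]] :=
      @sublinear_chain_inf S [set sval s | s in A].
  + by exists (sval s0), s0.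
  + exact: (svalP s).
  + by case: (tot _ _ As At) => /asboolP h; [right|left].
  + exists (exist _ m (conj hm mS)) => s As; apply/asboolP => v /=.
    by apply: mA; exists s.
exists q; split=> // q' hq' q'q.
have q'S v : q' v <= S v by exact: le_trans (q'q v) (qS v).
have := qmin (exist _ q' (conj hq' q'S)) => /(_ _)/(congr1 sval)/= -> //.
exact/asboolP.
Qed.

(* A minimal sublinear functional q is linear: for fixed v the functional
   x |-> inf_(t >= 0) (q (x + t v) - t q v) is sublinear and below q, so it
   equals q, whence q x <= q (x + v) - q v. *)
Lemma hahn_banach S : sublinear S ->
  exists2 f : V -> R, linear (f : V -> R^o) & forall v, f v <= S v.
Proof.
move=> /exists_minimal_sublinear[q [hq qS qmin]]; exists q => //.
have qD u v : q (u + v) = q u + q v.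
  apply/le_anti; rewrite hq.1/=.
  pose C := [set (- (t *: v), - (t * q v)) | t in [set t : R | 0 <= t]].
  have hC : convex_cone C.
    split; first by exists 0 => //=; rewrite scale0r mul0r !oppr0.
    - move=> _ _ [s /= s0 <-] [t /= t0 <-]; exists (s + t); first exact: addr_ge0.
      by rewrite scalerDl mulrDl !opprD.
    - move=> s _ s0 [t /= t0 <-]; exists (s * t); first exact: mulr_ge0.
      by rewrite /= scalerN scalerA mulrN mulrA.
  have hCq c : C c -> 0 <= q (- c.1) + c.2.
    by case=> t /= t0 <-; rewrite opprK/= hq.2// subrr.
  rewrite -[in X in X + _](qmin (cone_inf C q)).
  + have : C (- v, - q v) by exists 1 => //=; rewrite scale1r mul1r.
    move=> /(cone_inf_le hq hCq u) /=; rewrite opprK; lra.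
  + exact: sublinear_cone_inf.
  + by move=> w; exact: cone_inf_minorant.
have qN v : q (- v) = - q v.
  have := qD v (- v); rewrite subrr (sublinear0 hq); lra.
move=> a u v; rewrite qD; congr (_ + _); change (q (a *: u) = a * q u).
have [a0|a0] := leP 0 a; first exact: hq.2.
by rewrite -[X in X *: _]opprK scaleNr qN hq.2 ?oppr_ge0 ?ltW// mulNr opprK.
Qed.

(** Hahn-Banach applied to [cone_inf C S]. The norming functionals and the multipliers below come
    from it. *)
Lemma mazur_orlicz S C : sublinear S -> convex_cone C ->
  (forall c, C c -> 0 <= S (- c.1) + c.2) ->
  exists f : V -> R, [/\ linear (f : V -> R^o), forall v, f v <= S v &
                      forall c, C c -> f c.1 <= c.2].
Proof.
move=> hS hC hCS.
have [f flin fle] := hahn_banach (sublinear_cone_inf hC hS hCS).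
exists f; split=> // [v|c Cc].
  exact: le_trans (fle v) (cone_inf_minorant hC hS hCS v).
exact: le_trans (fle _) (cone_inf_constraint hS hCS Cc).
Qed.

End HahnBanach.

(** * Variational principles of Borwein-Preiss and Ekeland type *)

Lemma lipschitz_continuous (R : realType) (V : normedModType R) (q : V -> R) (c : R) :
  (forall x y, q x - q y <= c * `|x - y|) -> continuous q.
Proof.
move=> qlip x; apply/cvgrPdist_le => e e0; near=> w.
have c1 : 0 < `|c| + 1 by rewrite ltr_wpDl.
have : (`|c| + 1) * `|x - w| <= e.
  rewrite mulrC -ler_pdivlMr//; near: w.
  by apply: cvgr_dist_le; [exact: cvg_id|exact: divr_gt0].
have cc : c * `|x - w| <= (`|c| + 1) * `|x - w|.
  by rewrite ler_wpM2r// ler_wpDr// ler_norm.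
move=> /(le_trans cc) cw; rewrite ler_norml.
by have := qlip x w; have := qlip w x; rewrite (distrC w); lra.
Unshelve. all: by end_near. Qed.

Section SmoothVariationalPrinciple.
Context {R : realType} {V : normedModType R}.
(** Completeness is a hypothesis because the principle is applied to X * Y with its normed module
    structure alone. *)
Hypothesis V_complete :
  forall F : set_system V, ProperFilter F -> cauchy F -> cvg F.

Local Notation h := (GRing.exp (2^-1 : R)).

Let h_gt0 n : 0 < h n. Proof. by rewrite exprn_gt0. Qed.

Let hS n : h n.+1 = h n / 2. Proof. by rewrite exprSr. Qed.

Variables (N : V -> R) (K : R).
Hypotheses (K_gt0 : 0 < K) (ND : forall u v, N (u + v) <= N u + N v).
Hypotheses (N_le : forall u, N u <= K * `|u|) (N_ge : forall u, `|u| <= K * N u).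

Lemma equiv_norm_ge0 u : 0 <= N u.
Proof. by have := le_trans (normr_ge0 u) (N_ge u); rewrite pmulr_rge0. Qed.

Lemma equiv_norm0 : N 0 = 0.
Proof.
by apply/le_anti; rewrite equiv_norm_ge0 andbT -(mulr0 K) -(normr0 V) N_le.
Qed.

Lemma equiv_norm_dist u v w : N (u - w) <= N (u - v) + N (v - w).
Proof. by rewrite -[u - w](subrKA v). Qed.

Lemma near_minimizer (Om : set V) (psi : V -> R) (b e : R) :
  Om !=set0 -> 0 < e -> (forall v, Om v -> b <= psi v) ->
  exists2 z, Om z & forall v, Om v -> psi z <= psi v + e.
Proof.
move=> [v0 Omv0] e0 hb; pose A := [set psi v | v in Om].
have hA : has_inf A.
  by split; [exists (psi v0), v0|exists b => _ [v Omv <-]; exact: hb].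
have [_ [z Omz <-] hz] := inf_adherent e0 hA.
exists z => // v Omv; apply: le_trans (ltW hz) _; rewrite lerD2r.
by apply: ge_inf; [case: hA|exists v].
Qed.

Lemma equiv_norm_cvg (z : nat -> V) (r : R) :
  (forall n, N (z n.+1 - z n) <= r * h n.+1) ->
  exists2 zi, z @ \oo --> zi & forall n, N (zi - z n) <= r * h n.
Proof.
move=> hz.
(* [h n - h (n + m)] is the exact sum of the m weights from [h n.+1] on, so the induction closes
   without loss. *)
have hmn m n : N (z (n + m)%N - z n) <= r * (h n - h (n + m)%N).
  elim: m => [|m ih]; first by rewrite addn0 !subrr mulr0 equiv_norm0.
  rewrite addnS; apply: le_trans (equiv_norm_dist _ (z (n + m)%N) _) _.
  by have := hz (n + m)%N; rewrite hS; lra.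
have r0 : 0 <= r.
  by have := le_trans (equiv_norm_ge0 _) (hz 0%N); rewrite pmulr_lge0.
have hmn' m n : (n <= m)%N -> N (z m - z n) <= r * h n.
  move=> /subnKC <-; apply: le_trans (hmn _ _) _.
  by rewrite ler_wpM2l// gerBl ltW.
have h0 : h n @[n --> \oo] --> 0.
  by apply: cvg_expr; rewrite ger0_norm ?invr_ge0// invf_lt1// ltr1n.
have zc : cvg (z @ \oo).
  apply: V_complete; apply: cauchy_exP => e e0.
  have /cvgrPdist_lt/(_ _ e0)[n _ hn] : K * (r * h n) @[n --> \oo] --> 0.
    rewrite -(mulr0 K) -(mulr0 r).
    by apply: cvgM; [exact: cvg_cst|apply: cvgM => //; exact: cvg_cst].
  exists (z n); exists n => // m /= nm; rewrite -ball_normE/= -normrN opprB.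
  apply: le_lt_trans (N_ge _) _; have := hn n (leqnn n).
  rewrite /= sub0r normrN ger0_norm ?mulr_ge0 ?(ltW K_gt0)// ?ltW//.
  by apply: le_lt_trans; rewrite ler_pM2l// hmn'.
exists (lim (z @ \oo)) => // n.
have /cvgrPdist_le zl := zc; apply/ler_addgt0Pr => e e0.
have [|m _ hm] := zl (e / K); first exact: divr_gt0.
have := hm (maxn m n) (leq_maxl _ _) => /=.
rewrite ler_pdivlMr// mulrC => /(le_trans (N_le _)) h1.
apply: le_trans (equiv_norm_dist _ (z (maxn m n)) _) _; rewrite addrC lerD//.
exact/hmn'/leq_maxr.
Qed.

(** By [q0], [q_ge] and [q_lip], [q n] approximates N from below within [r * h n / 8]. For Ekeland's
    principle it is N itself, in the Asplund case a smooth substitute. *)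
Variables (q : nat -> V -> R) (k r : R) (Om : set V) (phi0 : V -> R) (z0 : V).
Hypotheses (k_gt0 : 0 < k) (r_gt0 : 0 < r).
Hypothesis q0 : forall n, q n 0 = 0.
Hypothesis q_ge : forall n v, N v - r * h n / 8 <= q n v.
Hypothesis q_lip : forall n u v, q n u - q n v <= N (u - v).
Hypotheses (Om_closed : closed Om) (Omz0 : Om z0).
Hypothesis phi0_cont : continuous phi0.
Hypothesis z0_min : forall v, Om v -> phi0 z0 <= phi0 v + k * r / 8.

(** Perturb around the current point with weight [k * h n.+1], then pick a near minimizer. Its error
    is quadratic in [h n.+1]; divided by the weight it leaves a step of order [h n.+1]. *)
Let next n (s : (V -> R) * V) : (V -> R) * V :=
  let psi v := s.1 v + k * h n.+1 * q n (v - s.2) in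
  (psi, xget s.2 [set z | Om z /\
                  forall v, Om v -> psi z <= psi v + k * r * h n.+1 ^+ 2 / 8]).

Let state := fix state n := if n is m.+1 then next m (state m) else (phi0, z0).
Let phi n := (state n).1.
Let z n := (state n).2.

Let phiS n v : phi n.+1 v = phi n v + k * h n.+1 * q n (v - z n).
Proof. by []. Qed.

Let zP n : Om (z n) /\
  forall v, Om v -> phi n (z n) <= phi n v + k * r * h n ^+ 2 / 8.
Proof.
(* Each perturbation lowers the function by at most [k * h m.+1 * (r * h m / 8)]. These losses are
   summable, so all stages are bounded below on Om and near minimizers exist. *)
have phi_ge m v : Om v -> phi0 z0 - k * r * (2 - h m) <= phi m v.
  move=> Omv; elim: m => [|m ih].
    have := z0_min Omv; have : 0 <= k * r by rewrite mulr_ge0// ltW.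
    by rewrite /phi/= expr0; lra.
  rewrite phiS; apply: le_trans (lerD ih (lexx _)).
  have : k * h m.+1 * (- (r * h m / 8)) <= k * h m.+1 * q m (v - z m).
    rewrite ler_pM2l ?mulr_gt0//; apply: le_trans (q_ge _ _).
    by rewrite lerBrDr addNr equiv_norm_ge0.
  have : k * r * (h m * h m) <= k * r * h m.
    rewrite ler_pM2l ?mulr_gt0// ler_piMr//.
    by rewrite exprn_ile1 ?invr_ge0 ?invf_le1 ?ler1n.
  have : 0 <= k * r * h m by rewrite !mulr_ge0// ltW.
  by rewrite hS; lra.
case: n => [|n].
  by split=> // v Omv; rewrite expr0 expr1n mulr1; exact: z0_min.
have [||zz Omzz hzz] := near_minimizer (e := k * r * h n.+1 ^+ 2 / 8) _ _
    (phi_ge n.+1); first by exists z0.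
  by rewrite divr_gt0// !mulr_gt0// exprn_gt0.
by apply: (@xgetPex _ (z n) [set z | Om z /\ forall v, Om v ->
  phi n.+1 z <= phi n.+1 v + k * r * h n.+1 ^+ 2 / 8]); exists zz.
Qed.

Let z_step n : N (z n.+1 - z n) <= r * h n.+1.
Proof.
have [Om1 m1] := zP n.+1; have [Om0 m0] := zP n.
have := m1 _ Om0; have := m0 _ Om1; rewrite !phiS subrr q0 mulr0 addr0.
have : k * h n.+1 * (N (z n.+1 - z n) - r * h n / 8) <=
       k * h n.+1 * q n (z n.+1 - z n).
  by rewrite ler_pM2l ?mulr_gt0.
move=> h1 h2 h3.
(* In units of [k * r * h n ^+ 2], the two minimization errors are 1/8 and 1/32 and the
   approximation error of [q n] is 1/16. Their sum 7/32 is below the 1/4 on the right. *)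
have : k * h n.+1 * N (z n.+1 - z n) <= k * h n.+1 * (r * h n.+1).
  have : 0 <= k * r * h n ^+ 2 by rewrite !mulr_ge0 ?ltW// exprn_gt0.
  by move: h1 h2 h3; rewrite hS; nra.
by rewrite ler_pM2l ?mulr_gt0.
Qed.

Let phi_cont n : continuous (phi n).
Proof.
elim: n => [//|n ih] v.
have qc : continuous (q n).
  apply: (@lipschitz_continuous _ _ _ K) => u w.
  exact: le_trans (q_lip n u w) (N_le _).
have -> : phi n.+1 = fun v => phi n v + k * h n.+1 * q n (v - z n) by [].
apply: cvgD; first exact: ih.
apply: cvgM; first exact: cvg_cst.
apply: (@continuous_comp _ _ _ (fun v => v - z n) (q n)); last exact: qc.
by apply: cvgB; [exact: cvg_id|exact: cvg_cst].
Qed.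

(** From stage n to stage n + m only perturbations of total weight [k * (h n - h (n + m))] are
    added, so the near minimality of [z (n + m)] passes to the limit. Stating it for every stage
    allows finite sums of smooth functions to be used, with an error of slope [k * h n]. *)
Theorem smooth_variational_principle :
  exists (z : nat -> V) (phi : nat -> V -> R) (zi : V),
  [/\ phi 0%N = phi0,
      forall n v, phi n.+1 v = phi n v + k * h n.+1 * q n (v - z n),
      Om zi, N (zi - z0) <= r &
      forall n v, Om v -> phi n zi <= phi n v + k * h n * N (v - zi)].
Proof.
have [zi z_zi hzi] := equiv_norm_cvg z_step.
have Omzi : Om zi.
  by apply: (closed_cvg Om Om_closed _ _ z_zi); near=> n; exact: (zP n).1.
exists z, phi, zi; split=> // [|n v Omv]; first by have := hzi 0%N; rewrite expr0 mulr1.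
have phi_lip m u w : phi (n + m)%N u - phi (n + m)%N w <=
    phi n u - phi n w + k * (h n - h (n + m)%N) * N (u - w).
  elim: m => [|m ih]; first by rewrite addn0 subrr mulr0 mul0r addr0.
  rewrite addnS !phiS.
  have : k * h (n + m).+1 * (q (n + m)%N (u - z (n + m)%N) -
     q (n + m)%N (w - z (n + m)%N)) <= k * h (n + m).+1 * N (u - w).
    rewrite ler_pM2l ?mulr_gt0//; apply: le_trans (q_lip _ _ _) _.
    by rewrite opprB addrA subrK.
  by move: ih; rewrite hS; lra.
have le_m m : phi n (z (n + m)%N) <= phi n v +
    k * h n * (N (v - zi) + r * h (n + m)%N) + k * r * h (n + m)%N ^+ 2 / 8.
  have := (zP (n + m)%N).2 _ Omv; have := phi_lip m v (z (n + m)%N).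
  have := equiv_norm_dist v zi (z (n + m)%N).
  have := hzi (n + m)%N.
  have hnm0 := h_gt0 (n + m)%N; have hn0 := h_gt0 n.
  have hnm : h (n + m)%N <= h n.
    by rewrite ler_wiXn2l ?leq_addr// ?invr_ge0// invf_le1// ler1n.
  have N0 := equiv_norm_ge0 (v - z (n + m)%N).
  move=> h1 h2 h3 h4.
  have : k * (h n - h (n + m)%N) * N (v - z (n + m)%N) <=
     k * h n * (N (v - zi) + r * h (n + m)%N).
    apply: ler_pM => //; last by lra.
      by rewrite mulr_ge0 ?subr_ge0// ltW.
    by rewrite ler_pM2l// gerBl ltW.
  by move: h3 h4; lra.
have h0 : h (n + m)%N @[m --> \oo] --> 0.
  apply: (cvg_comp (addn n) h (cvg_addnl n)).
  by apply: cvg_expr; rewrite ger0_norm ?invr_ge0// invf_lt1// ltr1n.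
have lim1 : phi n (z (n + m)%N) @[m --> \oo] --> phi n zi.
  apply: (@cvg_comp _ _ _ (fun m => z (n + m)%N) (phi n) _ (nbhs zi)).
    exact: (cvg_comp (addn n) z (cvg_addnl n)).
  exact: phi_cont.
have lim2 : phi n v + k * h n * (N (v - zi) + r * h (n + m)%N) +
    k * r * h (n + m)%N ^+ 2 / 8 @[m --> \oo] --> phi n v + k * h n * N (v - zi).
  rewrite -[X in _ --> X]addr0; apply: cvgD.
    apply: cvgD; first exact: cvg_cst.
    apply: cvgM; first exact: cvg_cst.
    rewrite -[X in _ --> X]addr0; apply: cvgD; first exact: cvg_cst.
    by rewrite -[X in _ --> X](mulr0 r); apply: cvgM => //; exact: cvg_cst.
  rewrite -(mul0r (8^-1 : R)); apply: cvgM; last exact: cvg_cst.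
  rewrite -[X in _ --> X](mulr0 (k * r)); apply: cvgM; first exact: cvg_cst.
  by rewrite -[X in _ --> X](mulr0 0); under eq_fun do rewrite expr2; exact: cvgM.
by apply: (ler_cvg_to lim1 lim2); near=> m; exact: le_m.
Unshelve. all: by end_near. Qed.

End SmoothVariationalPrinciple.

(** Stage 0 of the preceding principle with [q n := N], started from [phi + a * N (. - z0)]. The
    added term bounds the distance to z0, and the triangle inequality turns it into the slope a of
    the conclusion. *)
Theorem ekeland_variational_principle {R : realType} {V : normedModType R}
    (N : V -> R) (K : R) (Om : set V) (phi : V -> R) (z0 : V) (a k s : R) :
  (forall F : set_system V, ProperFilter F -> cauchy F -> cvg F) ->
  0 < K -> (forall u v, N (u + v) <= N u + N v) -> (forall u, N (- u) = N u) ->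
  (forall u, N u <= K * `|u|) -> (forall u, `|u| <= K * N u) ->
  closed Om -> Om z0 -> continuous phi -> (forall v, Om v -> 0 <= phi v) ->
  0 <= a -> 0 < k -> 0 < s ->
  exists z, [/\ Om z, phi z + a * N (z - z0) <= phi z0 + s &
    forall v, Om v -> phi z <= phi v + (a + k) * N (v - z)].
Proof.
move=> Vc K0 ND NN NK KN Omc Omz0 phic phi0 a0 k0 s0.
have N0 := equiv_norm_ge0 K0 KN.
pose phi1 v := phi v + a * N (v - z0).
have phi1_ge0 v : Om v -> 0 <= phi1 v.
  by move=> Omv; rewrite addr_ge0 ?phi0// mulr_ge0.
(* With [k * r = s / 2], the errors [k * r / 8] of z1 and [k * r] of the principle together stay
   below s. *)
pose r := s / (2 * k).
have r0 : 0 < r by rewrite divr_gt0// mulr_gt0.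
have kr : k * r = s / 2 by rewrite /r; field; rewrite gt_eqF.
have [||z1 Omz1 z1min] := near_minimizer (e := k * r / 8) _ _ phi1_ge0.
- by exists z0.
- by rewrite divr_gt0// mulr_gt0.
have phi1c : continuous phi1.
  move=> u; apply: cvgD; first exact: phic.
  apply: cvgM; first exact: cvg_cst.
  apply: (@lipschitz_continuous _ _ _ K) => v w; apply: le_trans (NK _).
  by have := equiv_norm_dist ND v w z0; lra.
have [|||z [f [zi [f0 _ Omzi hzi hmin]]]] :=
  smooth_variational_principle Vc K0 ND NK KN (q := fun _ => N) k0 r0
    _ _ _ Omc Omz1 phi1c z1min.
- by move=> _; exact: (equiv_norm0 K0 NK KN).
- move=> n v; rewrite gerBl divr_ge0// mulr_ge0 ?ltW//.
- by move=> _ u v; rewrite lerBlDr -{1}(subrK v u) ND.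
exists zi; split=> // [|v Omv].
  have h1 : phi1 z0 = phi z0.
    by rewrite /phi1 subrr (equiv_norm0 K0 NK KN) mulr0 addr0.
  have h2 : k * N (z1 - zi) <= k * r by rewrite ler_pM2l// -NN opprB.
  have := z1min _ Omz0; have := hmin 0%N _ Omz1; rewrite f0 expr0 mulr1 h1.
  by rewrite -/(phi1 zi); lra.
have := hmin 0%N _ Omv; rewrite f0 expr0 mulr1 /phi1.
have := equiv_norm_dist ND v zi z0 => /(ler_wpM2l a0); lra.
Qed.

(** * Completeness and weighted norms on the product *)

Section ProductNorm.
Context {R : realType} {X Y : completeNormedModType R}.

Lemma prod_norm_ge (w : X * Y) : `|w.1| <= `|w| /\ `|w.2| <= `|w|.
Proof. by rewrite prod_normE !le_max !lexx orbT. Qed.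

Lemma prod_complete (F : set_system [the normedModType R of (X * Y)%type]) :
  ProperFilter F -> cauchy F -> cvg F.
Proof.
move=> FF Fc.
have Fc1 : cauchy (fst @ F).
  apply: cauchy_exP => e e0.
  have [z Fz] := (@cauchyP _ _ F FF).1 Fc _ e0.
  exists z.1; change (F [set w : X * Y | ball z.1 e w.1]).
  apply: filterS Fz => w; rewrite -!ball_normE/=.
  by apply: le_lt_trans; have [] := prod_norm_ge (z - w).
have Fc2 : cauchy (snd @ F).
  apply: cauchy_exP => e e0.
  have [z Fz] := (@cauchyP _ _ F FF).1 Fc _ e0.
  exists z.2; change (F [set w : X * Y | ball z.2 e w.2]).
  apply: filterS Fz => w; rewrite -!ball_normE/=.
  by apply: le_lt_trans; have [] := prod_norm_ge (z - w).
have Fx := @cauchy_cvg X _ _ Fc1; have Fy := @cauchy_cvg Y _ _ Fc2.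
apply/cvg_ex; exists (lim (fst @ F), lim (snd @ F)).
have -> : F = (fun z : X * Y => (z.1, z.2)) @ F.
  by apply/funext => A; congr (F _); apply/funext => -[].
exact: (cvg_pair (Fx _) (Fy _)).
Qed.

Lemma cvg_prod1 {T : Type} {F : set_system T} {FF : Filter F}
    (f : T -> X * Y) (w : X * Y) : f @ F --> w -> (f t).1 @[t --> F] --> w.1.
Proof.
by move=> fw; apply: (cvg_comp f fst fw); case: (w) => ? ?; exact: cvg_fst.
Qed.

Lemma cvg_prod2 {T : Type} {F : set_system T} {FF : Filter F}
    (f : T -> X * Y) (w : X * Y) : f @ F --> w -> (f t).2 @[t --> F] --> w.2.
Proof.
by move=> fw; apply: (cvg_comp f snd fw); case: (w) => ? ?; exact: cvg_snd.
Qed.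

(** A slope a for this norm is dual to the bounds a on X and [a * g] on Y, so a small g makes the
    perturbation of the functional on Y small. *)
Definition weighted_norm (g : R) (w : X * Y) : R := `|w.1| + g * `|w.2|.

Section Weight.
Variable g : R.
Hypothesis g_gt0 : 0 < g.

Lemma weighted_normD u v :
  weighted_norm g (u + v) <= weighted_norm g u + weighted_norm g v.
Proof.
have := ler_normD u.1 v.1; have := ler_normD u.2 v.2.
by rewrite -(ler_pM2l g_gt0) /weighted_norm/=; lra.
Qed.

Lemma weighted_normN u : weighted_norm g (- u) = weighted_norm g u.
Proof. by rewrite /weighted_norm/= !normrN. Qed.

Lemma weighted_norm_le u : weighted_norm g u <= (1 + g + g^-1) * `|u|.
Proof.
have [h1 h2] := prod_norm_ge u.
have : g * `|u.2| <= g * `|u| by rewrite ler_pM2l.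
have : 0 <= g^-1 * `|u| by rewrite mulr_ge0// invr_ge0 ltW.
by rewrite /weighted_norm; lra.
Qed.

Lemma weighted_norm_ge u : `|u| <= (1 + g + g^-1) * weighted_norm g u.
Proof.
have g1 : 0 <= g^-1 by rewrite invr_ge0 ltW.
have n1 := normr_ge0 u.1; have n2 := normr_ge0 u.2.
have gg : g^-1 * (g * `|u.2|) = `|u.2| by rewrite mulrA mulVf ?gt_eqF// mul1r.
have h1 : 0 <= g^-1 * `|u.1| by rewrite mulr_ge0.
have h2 : 0 <= g * `|u.1| by rewrite mulr_ge0// ltW.
have h3 : 0 <= g * `|u.2| by rewrite mulr_ge0// ltW.
have h4 : 0 <= g * (g * `|u.2|) by rewrite mulr_ge0// ltW.
by rewrite prod_normE ge_max /weighted_norm; apply/andP; split; lra.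
Qed.

Lemma weighted_const_gt0 : 0 < 1 + g + g^-1.
Proof. by rewrite !addr_gt0// invr_gt0. Qed.

End Weight.
End ProductNorm.

(** * Linear functionals and the dual norm *)

Section LinearFunctionals.
Context {R : realType} {V : lmodType R} {f : V -> R}.
Hypothesis flin : linear (f : V -> R^o).

Lemma functionalD u v : f (u + v) = f u + f v.
Proof. by have := flin 1 u v; rewrite !scale1r. Qed.

Lemma functional0 : f 0 = 0.
Proof. by have := functionalD 0 0; rewrite addr0; lra. Qed.

Lemma functionalZ (a : R) v : f (a *: v) = a * f v.
Proof. by have := flin a v 0; rewrite functional0 !addr0. Qed.

Lemma functionalN v : f (- v) = - f v.
Proof. by rewrite -scaleN1r functionalZ mulN1r. Qed.

Lemma functionalB u v : f (u - v) = f u - f v.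
Proof. by rewrite functionalD functionalN. Qed.

End LinearFunctionals.

Section DualFacts.
Context {R : realType} {V : normedModType R}.
Implicit Types f : V -> R.

Lemma functional_abs_le f (c : R) : linear (f : V -> R^o) ->
  (forall v, f v <= c * `|v|) -> forall v, `|f v| <= c * `|v|.
Proof.
move=> flin fc v.
by rewrite ler_norml fc andbT lerNl -(functionalN flin) -(normrN v) fc.
Qed.

Lemma bounded_dual f (c : R) : linear (f : V -> R^o) ->
  (forall v, `|f v| <= c * `|v|) -> dual f.
Proof.
move=> flin fc; split=> //; apply: (@lipschitz_continuous _ _ _ c) => u v.
rewrite -(functionalB flin); exact: le_trans (ler_norm _) (fc _).
Qed.

Lemma dual_norm_le f (c : R) : 0 <= c ->
  (forall v, `|f v| <= c * `|v|) -> (dual_norm f <= c%:E)%E.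
Proof.
move=> c0 fc; apply: ge_ereal_sup => _ [v /= v1 <-]; rewrite lee_fin.
by apply: le_trans (fc v) _; rewrite ler_piMr.
Qed.

Lemma dual_norm_ge f (v : V) (c : R) : linear (f : V -> R^o) -> v != 0 ->
  c * `|v| <= f v -> (c%:E <= dual_norm f)%E.
Proof.
move=> flin v0 cf; have nv : 0 < `|v| by rewrite normr_gt0.
apply: (@le_trans _ _ `|f (`|v|^-1 *: v)|%:E).
  rewrite lee_fin (functionalZ flin); apply: le_trans (ler_norm _).
  by rewrite ler_pdivlMl// mulrC.
apply: ereal_sup_ubound; exists (`|v|^-1 *: v) => //=.
by rewrite normrZ normfV normr_id mulVf// gt_eqF.
Qed.

End DualFacts.

(** * The Clarke tangent cone and its multiplier rule *)

Section ClarkeTangentCone.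
Context {R : realType} {V : normedModType R}.
Variables (Om : set V) (zbar : V).

Lemma clarke_tangent0 : clarke_tangent Om zbar 0.
Proof.
move=> z t Omz _ _ _; exists (fun _ => 0); first exact: cvg_cst.
by move=> k; rewrite scaler0 addr0.
Qed.

(** The sequence for v is taken at the moved base points [z k + t k *: u' k]; this works because the
    Clarke cone quantifies over all base sequences. *)
Lemma clarke_tangentD u v : clarke_tangent Om zbar u ->
  clarke_tangent Om zbar v -> clarke_tangent Om zbar (u + v).
Proof.
move=> hu hv z t Omz zz t0 tt; have [u' u'u Omu'] := hu z t Omz zz t0 tt.
have [|v' v'v Omv'] := hv (fun k => z k + t k *: u' k) t Omu' _ t0 tt.
  rewrite -[X in _ --> X]addr0; apply: cvgD; first exact: zz.
  by rewrite -[X in _ --> X](scale0r u); apply: cvgZ.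
exists (fun k => u' k + v' k); first exact: cvgD.
by move=> k; rewrite scalerDr addrA.
Qed.

Lemma clarke_tangentZ (s : R) v : 0 <= s -> clarke_tangent Om zbar v ->
  clarke_tangent Om zbar (s *: v).
Proof.
rewrite le_eqVlt => /predU1P[<- _|s0 hv z t Omz zz t0 tt].
  by rewrite scale0r; exact: clarke_tangent0.
have [||v' v'v Omv'] := hv z (fun k => t k * s) Omz zz.
- by move=> k; rewrite mulr_gt0.
- by rewrite -(mul0r s); apply: cvgM => //; exact: cvg_cst.
exists (fun k => s *: v' k); first by apply: cvgZ => //; exact: cvg_cst.
by move=> k; rewrite scalerA.
Qed.

Lemma clarke_tangent_contingent w : Om zbar -> clarke_tangent Om zbar w ->
  exists (t : nat -> R) (w' : nat -> V), [/\ forall k, 0 < t k, t @ \oo --> 0,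
    w' @ \oo --> w & forall k, Om (zbar + t k *: w' k)].
Proof.
move=> Omz hw; pose t (k : nat) : R := k.+1%:R^-1.
have t0 k : 0 < t k by rewrite invr_gt0.
have tt : t @ \oo --> 0 by exact: cvg_harmonic.
have [|w' w'w Omw'] := hw (fun _ => zbar) t (fun _ => Omz) _ t0 tt.
  exact: cvg_cst.
by exists t, w'.
Qed.

End ClarkeTangentCone.

Section ClarkeMultiplier.
Context {R : realType} {X Y : completeNormedModType R}.

(** Mazur-Orlicz on Y * (X * Y): the first factor carries [ystar], the second the pair (- [xs],
    [zs]). Keeping [ystar] apart from [zs] makes it norming for [y - ybar] exactly. *)
Lemma clarke_multiplier (Om : set (X * Y)) (x : X) (y ybar : Y) (a g : R) :
  Om (x, y) -> y != ybar -> 0 <= a -> 0 < g ->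
  (forall v, Om v -> `|y - ybar| <= `|v.2 - ybar| +
     a * weighted_norm g (v - (x, y))) ->
  exists (ystar zs : Y -> R) (xs : X -> R),
    [/\ [/\ linear (ystar : Y -> R^o), linear (zs : Y -> R^o) &
             linear (xs : X -> R^o)],
        [/\ forall v, `|ystar v| <= `|v|, ystar (y - ybar) = `|y - ybar|,
             forall v, `|zs v| <= a * g * `|v| & forall u, `|xs u| <= a * `|u|] &
        clarke_normal Om (x, y) (fun w => xs w.1 - (ystar w.2 + zs w.2))].
Proof.
move=> Omxy yy a0 g0 hmin; pose y0 := y - ybar.
pose S (w : Y * (X * Y)) := `|w.1| + a * weighted_norm g w.2.
(* The case w = 0, t = 1 gives [ystar y0 >= |y0|]; the case t = 0 says that the resulting functional
   is nonpositive on the tangent w. *)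
pose C := [set c : Y * (X * Y) * R | exists (w : X * Y) (t : R),
  [/\ clarke_tangent Om (x, y) w, 0 <= t &
       c = (- (w.2 + t *: y0, w), - (t * `|y0|))]].
have hS : sublinear S.
  split=> [u v|t v t0].
    have := weighted_normD g0 u.2 v.2 => /(ler_wpM2l a0).
    have := ler_normD u.1 v.1; rewrite /S/=; lra.
  by rewrite /S /weighted_norm/= !normrZ ger0_norm//; ring.
have hC : convex_cone C.
  split.
  - exists 0, 0; split => //; first exact: clarke_tangent0.
    by rewrite scale0r mul0r addr0 !oppr0.
  - move=> _ _ [w [s [hw s0 ->]]] [w' [t [hw' t0 ->]]]; exists (w + w'), (s + t).
    split; [exact: clarke_tangentD|exact: addr_ge0|].
    rewrite scalerDl mulrDl addrACA opprD; congr (_, _).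
    by rewrite -opprD.
  - move=> s _ s0 [w [t [hw t0 ->]]]; exists (s *: w), (s * t).
    split; [exact: clarke_tangentZ|exact: mulr_ge0|].
    by rewrite /= scalerN mulrN mulrA -scalerA -scalerDr.
have hCS c : C c -> 0 <= S (- c.1) + c.2.
  move=> [w [t [hw t0 ->]]]; rewrite opprK /S/=.
  have [s [w' [s0 ss w'w Omw']]] := clarke_tangent_contingent Omxy hw.
  have w'w1 : `|(w' k).1| @[k --> \oo] --> `|w.1|.
    by apply: cvg_norm; exact: cvg_prod1.
  have w'w2 : (w' k).2 @[k --> \oo] --> w.2.
    exact: cvg_prod2.
  have lim : `|(w' k).2 + t *: y0| + a * weighted_norm g (w' k) - t * `|y0|
      @[k --> \oo] --> `|w.2 + t *: y0| + a * weighted_norm g w - t * `|y0|.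
    apply: cvgB; last exact: cvg_cst.
    apply: cvgD; first by apply: cvg_norm; apply: cvgD => //; exact: cvg_cst.
    apply: cvgM; first exact: cvg_cst.
    apply: cvgD => //; apply: cvgM; first exact: cvg_cst.
    exact: cvg_norm.
  have t1 : 0 < t + 1 by rewrite ltr_wpDl.
  apply: (cvgr_to_ge lim); near=> k.
  (* Makes the coefficient [1 - s k * t] in the splitting below nonnegative; bounding by
     [(t + 1)^-1] also covers t = 0. *)
  have st : s k * t <= 1.
    have : s k <= (t + 1)^-1.
      near: k; have /cvgrPdist_le/(_ (t + 1)^-1) := ss.
      rewrite invr_gt0 => /(_ t1); apply: filterS => k.
      by rewrite sub0r normrN; apply: le_trans; exact: ler_norm.
    rewrite -(ler_pM2r t1) mulVf ?gt_eqF// mulrDr mulr1.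
    by have := s0 k; lra.
  have := hmin _ (Omw' k).
  have -> : weighted_norm g ((x, y) + s k *: w' k - (x, y)) =
      s k * weighted_norm g (w' k).
    rewrite addrAC subrr add0r /weighted_norm/= !normrZ ger0_norm ?ltW//; ring.
  (* After the triangle inequality the term [(1 - s k * t) * |y0|] cancels against [|y0|], and
     division by [s k] leaves the difference quotient whose limit is wanted. *)
  have -> : ((x, y) + s k *: w' k).2 - ybar =
      s k *: ((w' k).2 + t *: y0) + (1 - s k * t) *: y0.
    rewrite /= scalerDr scalerA -[RHS]addrA -scalerDl.
    have -> : s k * t + (1 - s k * t) = 1 by ring.
    by rewrite scale1r addrAC addrC.
  move=> /le_trans/(_ (lerD (ler_normD _ _) (lexx _))).
  rewrite !normrZ (ger0_norm (ltW (s0 k))) ger0_norm ?subr_ge0// -/y0.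
  by move=> hk; rewrite -(ler_pM2l (s0 k)); move: hk; lra.
have [f [flin fS fC]] := mazur_orlicz hS hC hCS.
have fE := functionalD flin; have fZ := functionalZ flin.
pose ystar v := f (v, 0); pose zs v := f (0, (0, v)).
pose xs u := - f (0, (u, 0)).
have ylin : linear (ystar : Y -> R^o).
  by move=> b u v; rewrite /ystar -flin; congr f; rewrite -[RHS]/(_, _) /= scaler0 addr0.
have zlin : linear (zs : Y -> R^o).
  move=> b u v; rewrite /zs -flin; congr f.
  by rewrite -[RHS]/(_, (_, _)) /= !scaler0 !addr0.
have xlin : linear (xs : X -> R^o).
  move=> b u v; rewrite /xs scalerN -opprD -flin; congr (- f _).
  by rewrite -[RHS]/(_, (_, _)) /= !scaler0 !addr0.
have yle : forall v, `|ystar v| <= `|v|.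
  move=> v; rewrite -[leRHS]mul1r; apply: functional_abs_le => // {}v.
  by have := fS (v, 0); rewrite /S/weighted_norm/= !normr0 mulr0 addr0 mulr0 addr0 mul1r.
have fsplit v u w : f (v, (u, w)) = ystar v - xs u + zs w.
  rewrite /ystar /xs opprK -!fE; congr f.
  by rewrite -[RHS]/(_, (_, _)) /= !(add0r, addr0).
have hz : forall v, `|zs v| <= a * g * `|v|.
  move=> v; apply: functional_abs_le => // {}v.
  have := fS (0, (0, v)); rewrite /S/weighted_norm/= !normr0 !add0r.
  by rewrite mulrA.
have hx : forall u, `|xs u| <= a * `|u|.
  move=> v; apply: functional_abs_le => // {}v.
  have := fS (- (0, (v, 0))); rewrite (functionalN flin) /S/weighted_norm/=.
  by rewrite oppr0 !normr0 add0r mulr0 addr0 normrN.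
exists ystar, zs, xs; split=> //.
  split=> //.
    apply/le_anti; rewrite (le_trans (ler_norm _) (yle _))/=.
  have /fC : C (- (y0, 0), - `|y0|).
    exists 0, 1; split=> //; first exact: clarke_tangent0.
    by rewrite scale1r mul1r add0r.
  by rewrite (functionalN flin) lerN2.
split=> [|w hw].
  apply: (@bounded_dual _ _ _ (a + 1 + a * g)) => [b u v /=|v].
    rewrite ylin zlin xlin /GRing.scale/=; ring.
  have [v1 v2] := prod_norm_ge v.
  have ag0 : 0 <= a * g by rewrite mulr_ge0// ltW.
  have := ler_normB (xs v.1) (ystar v.2 + zs v.2).
  have := ler_normD (ystar v.2) (zs v.2).
  have := yle v.2; have := ler_wpM2l a0 v1; have := ler_wpM2l ag0 v2.
  have := hz v.2; have := hx v.1; lra.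
have /fC : C (- (w.2, w), 0).
  by exists w, 0; split=> //; rewrite scale0r addr0 mul0r oppr0.
rewrite (functionalN flin) oppr_le0; case: w {hw} => u v; rewrite fsplit/=; lra.
Unshelve. all: by end_near. Qed.

End ClarkeMultiplier.

(** * Ultrafilter limits and smooth approximations of the norm *)

Section UltrafilterLimits.
Context {R : realType} {T : Type} {U : set_system T}.
Hypothesis UU : UltraFilter U.

Lemma ultra_bounded_cvg (k : T -> R) (c : R) :
  U [set t | `|k t| <= c] -> exists l : R, k @ U --> l.
Proof.
move=> Uc.
have : (k @ U) `[- c, c]%classic.
  change (U [set t | k t \in `[- c, c]]).
  by apply: filterS Uc => t /=; rewrite in_itv/= ler_norml.
move=> /(segment_compact _)[l [_ kl]]; exists l; apply/cvgrPdist_lt => e e0.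
have [//|kc] := in_ultra_setVsetC [set t | `|l - k t| < e] UU.
have /kl/(_ (nbhsx_ballx l e e0))[x [/= + xe]] :
    (k @ U) [set x | ~ `|l - x| < e] by [].
by move: xe; rewrite -ball_normE.
Qed.

Lemma ultra_cvg_le (k l : T -> R) (a b : R) : k @ U --> a -> l @ U --> b ->
  U [set t | k t <= l t] -> a <= b.
Proof.
move=> ka lb kl; rewrite -subr_ge0; apply: (cvgr_to_ge (cvgB lb ka)).
by apply: filterS kl => t /=; rewrite subr_ge0.
Qed.

End UltrafilterLimits.

Section SmoothPenalty.
Context {R : realType} {V : normedModType R}.
Variable L : set V.
Hypothesis L0 : L 0.

Definition unit_functional (f : V -> R) : Prop :=
  linear (f : V -> R^o) /\ forall v, `|f v| <= `|v|.

Lemma unit_functional_mid f g : unit_functional f -> unit_functional g ->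
  unit_functional (fun v => (f v + g v) / 2).
Proof.
move=> [fl f1] [gl g1]; split=> [a u v|v].
  by rewrite fl gl /GRing.scale/=; field.
rewrite normrM normfV (ger0_norm (_ : 0 <= 2))// ler_pdivrMr//.
by have := ler_normD (f v) (g v); have := f1 v; have := g1 v; lra.
Qed.

Lemma exists_norming (x : V) :
  exists2 f, unit_functional f & f x = `|x|.
Proof.
(* These are the multiples of the constraint [f (- x) <= - |x|]. *)
pose C := [set (- (t *: x), - (t * `|x|)) | t in [set t : R | 0 <= t]].
have [||c [t /= t0 <-]|f [flin fS fC]] := @mazur_orlicz R V (fun v => `|v|) C.
- by split=> [u v|t v t0]; [exact: ler_normD|rewrite normrZ ger0_norm].
- split; first by exists 0 => //=; rewrite scale0r mul0r !oppr0.
  + move=> _ _ [s /= s0 <-] [t /= t0 <-]; exists (s + t); first exact: addr_ge0.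
    by rewrite scalerDl mulrDl !opprD.
  + move=> s _ s0 [t /= t0 <-]; exists (s * t); first exact: mulr_ge0.
    by rewrite /= scalerN scalerA mulrN mulrA.
- by rewrite /= opprK normrZ ger0_norm// subrr.
have f1 v : `|f v| <= `|v|.
  by rewrite -[leRHS]mul1r; apply: functional_abs_le => // {}v; rewrite mul1r.
exists f => //; apply/le_anti; rewrite fS/=.
have /fC : C (- x, - `|x|) by exists 1 => //=; rewrite scale1r mul1r.
by rewrite (functionalN flin) lerN2.
Qed.

Variable e : nat -> V -> R.
Hypothesis e1 : forall n, unit_functional (e n).
Hypothesis e_dense : forall f, unit_functional f -> forall s : R, 0 < s ->
  exists n, forall v, L v -> `|f v - e n v| <= s * `|v|.

(** [dst n f] is the norm of [f - e n] restricted to L. At v = 0 the ratio is 0, since the inverse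
    of 0 is 0. *)
Let ratio n f v := `|f v - e n v| / `|v|.
Let dst n f := sup [set ratio n f v | v in L].

Let ratio_le n f v : unit_functional f -> ratio n f v <= 2.
Proof.
move=> [fl f1]; have [en1 en2] := e1 n.
have [->|v0] := eqVneq v 0; first by rewrite /ratio normr0 invr0 mulr0.
rewrite /ratio ler_pdivrMr ?normr_gt0//.
by have := ler_normB (f v) (e n v); have := f1 v; have := en2 v; lra.
Qed.

Let dst_has_sup n f : unit_functional f -> has_sup [set ratio n f v | v in L].
Proof.
move=> f1; split; first by exists (ratio n f 0), 0.
by exists 2 => _ [v _ <-]; exact: ratio_le.
Qed.

Let dst_ub n f v : unit_functional f -> L v ->
  `|f v - e n v| <= dst n f * `|v|.
Proof.
move=> f1 Lv; have [->|v0] := eqVneq v 0.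
  by rewrite (functional0 f1.1) (functional0 (e1 n).1) subrr !normr0 mulr0.
rewrite -ler_pdivrMr ?normr_gt0//; apply: ub_le_sup; last by exists v.
by case: (dst_has_sup n f1).
Qed.

Let dst_le n f (c : R) : 0 <= c ->
  (forall v, L v -> `|f v - e n v| <= c * `|v|) -> dst n f <= c.
Proof.
move=> c0 h; apply: ge_sup; first by exists (ratio n f 0), 0.
move=> _ [v Lv <-]; have [->|v0] := eqVneq v 0.
  by rewrite /ratio normr0 invr0 mulr0.
by rewrite /ratio ler_pdivrMr ?normr_gt0// h.
Qed.

Let dst_ge0 n f : unit_functional f -> 0 <= dst n f.
Proof.
move=> f1; apply: (@le_trans _ _ (ratio n f 0)).
  by rewrite /ratio divr_ge0.
by apply: ub_le_sup; [case: (dst_has_sup n f1)|exists 0].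
Qed.

Let dst_le2 n f : unit_functional f -> dst n f <= 2.
Proof.
move=> f1; apply: dst_le => // v Lv.
by have := ler_normB (f v) (e n v); have := f1.2 v; have := (e1 n).2 v; lra.
Qed.

Let dst_mid n f g : unit_functional f -> unit_functional g ->
  dst n (fun v => (f v + g v) / 2) <= (dst n f + dst n g) / 2.
Proof.
move=> f1 g1; apply: dst_le => [|v Lv].
  by rewrite divr_ge0// addr_ge0// dst_ge0.
have := dst_ub n f1 Lv; have := dst_ub n g1 Lv.
have -> : (f v + g v) / 2 - e n v = ((f v - e n v) + (g v - e n v)) / 2 by field.
rewrite normrM normfV (ger0_norm (_ : 0 <= 2))//.
by have := ler_normD (f v - e n v) (g v - e n v); lra.
Qed.

Local Notation w := (GRing.exp (2^-1 : R)).

Let w_gt0 n : 0 < w n. Proof. by rewrite exprn_gt0. Qed.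

Let energyN f m := \sum_(n < m) w n * dst n f ^+ 2.
Let energy f := sup (range (energyN f)).

Let energyNS f m : energyN f m.+1 = energyN f m + w m * dst m f ^+ 2.
Proof. by rewrite /energyN big_ord_recr. Qed.

Let energyN_mono f m n : (m <= n)%N -> energyN f m <= energyN f n.
Proof.
move=> /subnKC <-; elim: (n - m)%N => [|k ih]; first by rewrite addn0.
rewrite addnS energyNS; apply: le_trans ih _; rewrite lerDl.
by rewrite mulr_ge0 ?sqr_ge0// ltW.
Qed.

(** Each squared distance is at most 4, and the weights below m sum to [2 * (1 - w m)]. *)
Let energyN_le f m : unit_functional f -> energyN f m <= 8 * (1 - w m).
Proof.
move=> f1; elim: m => [|m ih].
  by rewrite /energyN big_ord0 expr0 subrr mulr0.
rewrite energyNS (exprSr _ m).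
have : w m * dst m f ^+ 2 <= w m * 4.
  rewrite ler_pM2l//; have := dst_le2 m f1; have := dst_ge0 m f1; nra.
by move: ih; lra.
Qed.

Let energy_has_sup f : unit_functional f -> has_sup (range (energyN f)).
Proof.
move=> f1; split; first by exists (energyN f 0%N), 0%N.
exists 8 => _ [m _ <-]; apply: le_trans (energyN_le m f1) _.
by have := w_gt0 m; lra.
Qed.

Let energy_ub f m : unit_functional f -> energyN f m <= energy f.
Proof.
move=> f1; apply: ub_le_sup; last by exists m.
by case: (energy_has_sup f1).
Qed.

Let energy_le f (c : R) : (forall m, energyN f m <= c) -> energy f <= c.
Proof.
move=> h; apply: ge_sup; first by exists (energyN f 0%N), 0%N.
by move=> _ [m _ <-].
Qed.

Let energy_ge0 f : unit_functional f -> 0 <= energy f.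
Proof.
move=> f1; have := energy_ub 0%N f1.
by rewrite /energyN big_ord0.
Qed.

Let energy_le8 f : unit_functional f -> energy f <= 8.
Proof.
move=> f1; apply: energy_le => m; apply: le_trans (energyN_le m f1) _.
by have := w_gt0 m; lra.
Qed.

(** The parallelogram identity for the n-th term yields the quadratic gain; the other terms
    contribute midpoint convexity only. *)
Let energy_mid n f g : unit_functional f -> unit_functional g ->
  energy (fun v => (f v + g v) / 2) + w n / 4 * (dst n f - dst n g) ^+ 2 <=
  (energy f + energy g) / 2.
Proof.
move=> f1 g1; rewrite -lerBrDr; apply: energy_le => m; rewrite lerBrDr.
pose fg v := (f v + g v) / 2.
have term k : w k * dst k fg ^+ 2 + w k / 4 * (dst k f - dst k g) ^+ 2 <=
    (w k * dst k f ^+ 2 + w k * dst k g ^+ 2) / 2.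
  have -> : (w k * dst k f ^+ 2 + w k * dst k g ^+ 2) / 2 =
    w k * ((dst k f + dst k g) / 2) ^+ 2 + w k / 4 * (dst k f - dst k g) ^+ 2.
    by field.
  rewrite lerD2r ler_pM2l// lerXn2r ?nnegrE ?dst_mid//.
    exact/dst_ge0/unit_functional_mid.
  by rewrite divr_ge0// addr_ge0// dst_ge0.
have weak k : energyN fg k <= (energyN f k + energyN g k) / 2.
  elim: k => [|k ih]; first by rewrite /energyN !big_ord0 addr0 mul0r.
  rewrite !energyNS; have := term k.
  have : 0 <= w k / 4 * (dst k f - dst k g) ^+ 2.
    by rewrite mulr_ge0 ?sqr_ge0// divr_ge0// ltW.
  by move: ih; lra.
(* The gain is present in partial sums of length at least n + 1; monotonicity transfers the bound to
   shorter ones. *)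
have strong k : energyN fg (n.+1 + k)%N + w n / 4 * (dst n f - dst n g) ^+ 2 <=
    (energyN f (n.+1 + k)%N + energyN g (n.+1 + k)%N) / 2.
  elim: k => [|k ih].
    rewrite addn0 !energyNS; have := term n; have := weak n; lra.
  rewrite addnS !(energyNS _ (n.+1 + k)%N); have := term (n.+1 + k)%N.
  have : 0 <= w (n.+1 + k)%N / 4 *
      (dst (n.+1 + k)%N f - dst (n.+1 + k)%N g) ^+ 2.
    by rewrite mulr_ge0 ?sqr_ge0// divr_ge0// ltW.
  by move: ih; lra.
have := strong m; have := energyN_mono fg (leq_addl n.+1 m).
by have := energy_ub (n.+1 + m)%N f1; have := energy_ub (n.+1 + m)%N g1; lra.
Qed.

Variable s : R.
Hypothesis s_gt0 : 0 < s.

(** P is the convex conjugate of [s * energy] on the dual unit ball; without the energy term it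
    would be the norm. *)
Let objective x f := f x - s * energy f.
Let P x := sup [set objective x f | f in unit_functional].

Let objective_has_sup x : has_sup [set objective x f | f in unit_functional].
Proof.
split; first by have [f f1 _] := exists_norming 0; exists (objective x f), f.
exists `|x| => _ [f f1 <-]; have := ler_norm (f x); have := f1.2 x.
have : 0 <= s * energy f by rewrite mulr_ge0 ?energy_ge0// ltW.
by rewrite /objective; lra.
Qed.

Let P_ub x f : unit_functional f -> objective x f <= P x.
Proof.
by move=> f1; apply: ub_le_sup; [case: (objective_has_sup x)|exists f].
Qed.

(* Compactness of the dual unit ball in the topology of pointwise convergence,
   in the form of limits along an ultrafilter of maximizing functionals. *)
Let P_attained x : exists2 f, unit_functional f & P x = objective x f.
Proof.
pose near_max (d : R) := [set f | unit_functional f /\ P x - d <= objective x f].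
have [|U [UU sU]] := @ultraFilterLemma _ (filter_from [set d : R | 0 < d] near_max).
  apply: filter_from_proper.
    apply: filter_from_filter; first by exists 1 => /=.
    move=> c d /= c0 d0; exists (Num.min c d); first by rewrite lt_min c0.
    move=> f [f1 fd]; have : Num.min c d <= c by rewrite ge_min lexx.
    have : Num.min c d <= d by rewrite ge_min lexx orbT.
    by move=> md mc; do 2?split => //; lra.
  move=> d /= d0.
  have [_ [f f1 <-] hf] := sup_adherent d0 (objective_has_sup x).
  by exists f; split=> //; exact: ltW.
have U1 : U unit_functional by apply: sU; exists 1 => //= f [].
have /choice[f0 f0E] v : exists l : R, (fun f : V -> R => f v) @ U --> l.
  apply: (@ultra_bounded_cvg _ _ _ UU _ `|v|).
  by apply: filterS U1 => f [_ f1]; exact: f1.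
have /choice[l lE] n : exists l : R, dst n @ U --> l.
  apply: (@ultra_bounded_cvg _ _ _ UU _ 2); apply: filterS U1 => f f1.
  by rewrite /= ger0_norm ?dst_ge0// dst_le2.
have f01 : unit_functional f0.
  split=> [a u v|v].
    have h1 : (fun f : V -> R => f (a *: u + v) - (a * f u + f v)) @ U -->
        f0 (a *: u + v) - (a * f0 u + f0 v).
      by apply: cvgB => //; apply: cvgD => //; apply: cvgM => //; exact: cvg_cst.
    have h0 : U [set f | f (a *: u + v) - (a * f u + f v) = 0].
      by apply: filterS U1 => f [flin _] /=; rewrite flin subrr.
    apply/eqP; rewrite -subr_eq0; apply/eqP/le_anti/andP; split.
      by apply: (cvgr_to_le h1); apply: filterS h0 => f /= ->.
    by apply: (cvgr_to_ge h1); apply: filterS h0 => f /= ->.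
  have h1 : (fun f : V -> R => `|f v|) @ U --> `|f0 v| by exact: cvg_norm.
  by apply: (cvgr_to_le h1); apply: filterS U1 => f [_ f1]; exact: f1.
(* Lower semicontinuity of [dst n] under pointwise limits, which makes the energy lower
   semicontinuous as well. *)
have dst_f0 n : dst n f0 <= l n.
  have l0 : 0 <= l n.
    by apply: (cvgr_to_ge (lE n)); apply: filterS U1 => f /(dst_ge0 n).
  apply: dst_le => // v Lv.
  have h1 : (fun f : V -> R => `|f v - e n v|) @ U --> `|f0 v - e n v|.
    by apply: cvg_norm; apply: cvgB => //; exact: cvg_cst.
  have h2 : (fun f : V -> R => dst n f * `|v|) @ U --> l n * `|v|.
    by apply: cvgM => //; exact: cvg_cst.
  by apply: (ultra_cvg_le _ h1 h2); apply: filterS U1 => f f1; exact: dst_ub.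
exists f0 => //; apply/le_anti; rewrite P_ub// andbT.
rewrite /objective lerBrDr addrC -lerBrDr -ler_pdivlMl//.
apply: energy_le => m; rewrite ler_pdivlMl//.
apply: (@le_trans _ _ (s * \sum_(n < m) w n * l n ^+ 2)).
  rewrite ler_pM2l//; apply: ler_sum => n _; rewrite ler_pM2l//.
  rewrite lerXn2r ?nnegrE ?dst_ge0//; apply: le_trans (dst_f0 n).
  exact: dst_ge0.
have h1 : (fun f => s * energyN f m) @ U --> s * \sum_(n < m) w n * l n ^+ 2.
  apply: cvgM; first exact: cvg_cst.
  elim: m => [|m ih].
    rewrite big_ord0; under eq_fun do rewrite /energyN big_ord0.
    exact: cvg_cst.
  rewrite big_ord_recr; under eq_fun do rewrite energyNS.
  apply: cvgD => //; apply: cvgM; first exact: cvg_cst.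
  by under eq_fun do rewrite expr2; rewrite expr2; exact: cvgM.
apply/ler_addgt0Pr => d d0.
have h2 : (fun f : V -> R => f x - P x + d) @ U --> f0 x - P x + d.
  by apply: cvgD; [apply: cvgB => //; exact: cvg_cst|exact: cvg_cst].
apply: (ultra_cvg_le _ h1 h2).
have : U (near_max d) by apply: sU; exists d.
apply: filterS => f [f1]; rewrite /objective/=.
have : s * energyN f m <= s * energy f by rewrite ler_pM2l// energy_ub.
by lra.
Qed.

Let P_lip x y : P x - P y <= `|x - y|.
Proof.
have [f f1 ->] := P_attained x; have := P_ub y f1; rewrite /objective.
have := f1.2 (x - y); have := ler_norm (f (x - y)).
by rewrite (functionalB f1.1); lra.
Qed.

Let P_ge x : `|x| - s * 8 <= P x.
Proof.
have [f f1 fx] := exists_norming x; apply: le_trans (P_ub x f1).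
by rewrite /objective fx lerD2l lerN2 ler_pM2l// energy_le8.
Qed.

(* If f maximizes at x and g at x + v, then convexity of the energy forces
   dst n f and dst n g to be close for every n; choosing n with e n close to f
   makes g close to f on L. *)
Let P_superdiff x f : unit_functional f -> P x = objective x f ->
  forall t : R, 0 < t -> exists2 d : R, 0 < d &
    forall v, L v -> `|v| < d -> P (x + v) <= P x + f v + t * `|v|.
Proof.
move=> f1 Px t t0; have t30 : 0 < t / 3 by rewrite divr_gt0.
have [n fn] := e_dense f1 t30.
have fnt : dst n f <= t / 3 by apply: dst_le => //; exact: ltW.
(* By convexity [s * w n / 4 * (dst n f - dst n g) ^+ 2] is at most [|v|]; below this radius the two
   distances differ by less than t / 3. *)
exists (s * w n / 4 * (t / 3) ^+ 2) => [|v Lv vd].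
  by rewrite !mulr_gt0 ?exprn_gt0// invr_gt0.
have [g g1 Pxv] := P_attained (x + v).
have gx : P x - 2 * `|v| <= objective x g.
  have := P_lip x (x + v); rewrite opprD addNKr normrN Pxv /objective.
  by have := ler_norm (g v); have := g1.2 v; rewrite (functionalD g1.1); lra.
have mid := P_ub x (unit_functional_mid f1 g1).
have := energy_mid n f1 g1; rewrite -(ler_pM2l s_gt0) => emid.
have : s * w n / 4 * (dst n f - dst n g) ^+ 2 <= `|v|.
  by move: Px gx mid emid; rewrite /objective; lra.
move=> /le_lt_trans/(_ vd); rewrite ltr_pM2l; last first.
  by rewrite !mulr_gt0// invr_gt0.
move=> h; have gnt : dst n g <= 2 * t / 3.
  rewrite leNgt; apply/negP => hg; move: h; rewrite ltNge => /negP; apply.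
  have : t / 3 <= dst n g - dst n f by lra.
  by nra.
have gf : g v - f v <= t * `|v|.
  have := dst_ub n f1 Lv; have := dst_ub n g1 Lv.
  have := ler_norm (g v - e n v); have := ler_norm (- (f v - e n v)).
  rewrite normrN; have := ler_wpM2r (normr_ge0 v) fnt.
  by have := ler_wpM2r (normr_ge0 v) gnt; lra.
have := P_ub x g1; rewrite Pxv /objective (functionalD g1.1).
by move: gf; lra.
Qed.

Lemma exists_smooth_penalty : exists q : V -> R,
  [/\ q 0 = 0, forall x, `|x| - s * 8 <= q x, forall x y, q x - q y <= `|x - y| &
    forall x, exists f, [/\ unit_functional f, q x - s * 8 <= f x &
      forall t : R, 0 < t -> exists2 d : R, 0 < d &
        forall v, L v -> `|v| < d -> q (x + v) <= q x + f v + t * `|v|]].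
Proof.
have P00 : P 0 <= 0.
  have [f f1 ->] := P_attained 0; rewrite /objective (functional0 f1.1).
  by rewrite sub0r oppr_le0 mulr_ge0 ?energy_ge0// ltW.
exists (fun x => P x - P 0); split.
- exact: subrr.
- by move=> x; have := P_ge x; lra.
- by move=> x y; have := P_lip x y; lra.
- move=> x; have [f f1 Px] := P_attained x; exists f; split=> //.
    have := P_ge 0; rewrite normr0 Px /objective.
    have : 0 <= s * energy f by rewrite mulr_ge0 ?energy_ge0// ltW.
    by lra.
  move=> t /(P_superdiff f1 Px)[d d0 hd]; exists d => // v Lv vd.
  by have := hd v Lv vd; lra.
Qed.

End SmoothPenalty.

(** * Separable subspaces of Asplund spaces *)

Lemma exists_invn_lt (R : realType) (x : R) :
  0 < x -> exists k : nat, k.+1%:R^-1 < x.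
Proof.
move=> x0; exists (Num.trunc x^-1).
by rewrite invf_plt ?posrE ?ltr0Sn// truncnS_gt.
Qed.

Section AsplundSubspace.
Context {R : realType} {V : completeNormedModType R}.

Lemma subspace_dual_norm_bound (L : set V) (f : V -> R) (s : R) :
  linear_subspace L -> 0 <= s ->
  (forall (a : R) (u v : V), L u -> L v -> f (a *: u + v) = a * f u + f v) ->
  (subspace_dual_norm L f < s%:E)%E -> forall v, L v -> `|f v| <= s * `|v|.
Proof.
move=> [L0 Llin] s0 flin fs v Lv.
have f0 : f 0 = 0.
  by have := flin 1 0 0 L0 L0; rewrite scaler0 addr0; lra.
have [->|v0] := eqVneq v 0; first by rewrite f0 !normr0 mulr0.
have nv : 0 < `|v| by rewrite normr_gt0.
have LZ (a : R) : L (a *: v) by rewrite -[a *: v]addr0; exact: Llin.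
have fZ (a : R) : f (a *: v) = a * f v.
  by rewrite -[a *: v]addr0 flin// f0 addr0.
have : (`|f (`|v|^-1 *: v)|%:E < s%:E)%E.
  apply: le_lt_trans fs; apply: ereal_sup_ubound.
  exists (`|v|^-1 *: v) => //; split=> //.
  by rewrite normrZ normfV normr_id mulVf// gt_eqF.
rewrite lte_fin fZ normrM normfV normr_id => /ltW.
by rewrite ler_pdivrMl// mulrC.
Qed.

(** A dense sequence of the dual of L may leave the unit ball and consists of functions that are
    meaningful on L only. Hence, for each member and each precision, a unit functional on V that is
    close to it on L is chosen, if one exists. *)
Lemma asplund_dense_sequence (L : set V) :
  asplund V -> linear_subspace L -> separable_subset L ->
  exists e : nat -> V -> R, (forall n, unit_functional (e n)) /\
    forall f, unit_functional f -> forall s : R, 0 < s ->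
    exists n, forall v, L v -> `|f v - e n v| <= s * `|v|.
Proof.
move=> aV hL /(aV L hL)[D [/countable_injP[i iinj] DL Dd]].
pose good (m k : nat) := [set g : V -> R | unit_functional g /\
  exists2 d, D d & i d = m /\ forall v, L v -> `|g v - d v| <= k.+1%:R^-1 * `|v|].
have z1 : unit_functional (fun _ : V => 0 : R).
  by split=> [a u v|v]; rewrite ?normr0// /GRing.scale/= mulr0 addr0.
pose e (n : nat) : V -> R :=
  if unpickle n is Some (m, k) then xget (fun=> 0) (good m k) else fun=> 0.
exists e; split=> [n|f f1 s s0].
  rewrite /e; case: unpickle => [[m k]|//].
  by case: xgetP => [g _ []|].
(* The factor 2 pays for passing from f to d and from d to the chosen functional. *)
have [k ks] : exists k : nat, 2 * k.+1%:R^-1 <= s.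
  have [|k hk] := @exists_invn_lt _ (s / 2); first by rewrite divr_gt0.
  by exists k; move: hk; set t := _^-1; lra.
have fL : subspace_dual L f.
  split=> [a u v _ _|]; first by rewrite f1.1.
  apply: continuous_subspaceT.
  suff [] : dual f by [].
  by apply: (@bounded_dual _ _ _ 1) => [|v]; [exact: f1.1|rewrite mul1r f1.2].
have k0 : 0 < (k.+1%:R^-1 : R) by rewrite invr_gt0 ltr0Sn.
have [d Dd1 dk] := Dd f fL _ k0.
have fd v : L v -> `|f v - d v| <= k.+1%:R^-1 * `|v|.
  apply: (subspace_dual_norm_bound hL (ltW k0) _ dk) => //
   a u {}v Lu Lv /=; rewrite (DL _ Dd1).1// f1.1 /GRing.scale/=; ring.
exists (pickle (i d, k)) => v Lv; rewrite /e pickleK.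
case: xgetP => [g _ [g1 [d' Dd' [id' gd']]]|/(_ f)[]]; last first.
  by split=> //; exists d.
have dd' : d' = d by apply: iinj => //; rewrite inE.
have := gd' _ Lv; have := fd _ Lv; rewrite dd' => h1 h2.
have := ler_distD (d v) (f v) (g v); rewrite (distrC (d v)).
have := ler_wpM2r (normr_ge0 v) ks; move: h1 h2; set t := _^-1; lra.
Qed.

End AsplundSubspace.

(** * Reduction to separable subspaces *)

(** The closure is the set of values of all finite terms in the operations; terms are encoded as
    finite trees, which form a countable type. *)
Lemma countable_algebraic_closure (T : Type) (J : countType)
    (op : J -> T -> T -> T) (x0 : T) :
  exists D : set T, [/\ countable D, D x0 &
    forall j a b, D a -> D b -> D (op j a b)].
Proof.
pose fix ev (t : GenTree.tree J) : T :=
  match t with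
  | GenTree.Node _ [:: GenTree.Leaf j; a; b] => op j (ev a) (ev b)
  | _ => x0
  end.
exists (range ev); split.
- exact: card_le_trans (card_image_le _ _) (countableP _).
- by exists (GenTree.Node 0 [::]).
- move=> j _ _ [a _ <-] [b _ <-].
  by exists (GenTree.Node 0 [:: GenTree.Leaf j; a; b]).
Qed.

Section SeparableReduction.
Context {R : realType}.

Lemma closure_normP {V : normedModType R} (A : set V) (x : V) :
  closure A x <-> forall e : R, 0 < e -> exists2 d, A d & `|x - d| < e.
Proof.
split=> [Ax e e0|h B /nbhs_ballP[e /= e0 eB]].
  have [d [Ad]] := Ax _ (nbhsx_ballx x e e0).
  by rewrite -ball_normE; exists d.
have [d Ad xd] := h e e0; exists d; split=> //.
by apply: eB; rewrite -ball_normE.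
Qed.

Lemma closure_rat_subspace {V : normedModType R} (A : set V) :
  A 0 -> (forall (r : rat) a b, A a -> A b -> A (ratr r *: a + b)) ->
  linear_subspace (closure A).
Proof.
move=> A0 Alin; split=> [|c u v /closure_normP Au /closure_normP Av].
  exact: subset_closure.
apply/closure_normP => e e0; have e30 : 0 < e / 3 by rewrite divr_gt0.
have u1 : 0 < `|u| + 1 by rewrite ltr_wpDl.
have [r] : exists r : rat, ratr r \in `]c, c + e / 3 / (`|u| + 1)[.
  by apply: rat_in_itvoo; rewrite ltrDl divr_gt0.
rewrite in_itv/= => /andP[cr rc].
have r1 : 0 < `|ratr r : R| + 1 by rewrite ltr_wpDl.
have [a Aa ua] := Au _ (divr_gt0 e30 r1); have [b Ab vb] := Av _ e30.
exists (ratr r *: a + b); first exact: Alin.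
have -> : c *: u + v - (ratr r *: a + b) =
    (c - ratr r) *: u + ratr r *: (u - a) + (v - b).
  rewrite scalerBl scalerBr opprD addrACA; congr (_ + _).
  by rewrite addrA subrK.
apply: le_lt_trans (ler_normD _ _) _.
apply: le_lt_trans (lerD (ler_normD _ _) (lexx _)) _.
rewrite (normrZ (c - ratr r)) (normrZ (ratr r)).
have h1 : `|c - ratr r| * `|u| <= e / 3.
  rewrite distrC gtr0_norm ?subr_gt0//.
  apply: (@le_trans _ _ (e / 3 / (`|u| + 1) * (`|u| + 1))).
    apply: ler_pM; rewrite ?subr_ge0//; first exact: ltW.
      by rewrite lerBlDl; exact: ltW.
    by rewrite lerDl.
  by rewrite divfK// gt_eqF.
have h2 : `|ratr r : R| * `|u - a| <= e / 3.
  apply: (@le_trans _ _ ((`|ratr r : R| + 1) * (e / 3 / (`|ratr r : R| + 1)))).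
    by apply: ler_pM; rewrite ?lerDl//; exact: ltW.
  by rewrite mulrC divfK// gt_eqF.
by lra.
Qed.

(** A countable set D is closed under rational combinations, mixing of coordinates and the choice of
    witness lists. Openness of Q lets the lists chosen at points of D serve points of the
    closures. *)
Lemma separable_reduction {X Y : completeNormedModType R} (I : countType)
    (Q : I -> X * Y -> seq (X * Y) -> Prop) (z0 z1 : X * Y) :
  (forall i l z, Q i z l -> exists2 e : R, 0 < e &
     forall z', `|z' - z| < e -> Q i z' l) ->
  exists (LX : set X) (LY : set Y),
  [/\ [/\ linear_subspace LX, closed LX & separable_subset LX],
      [/\ linear_subspace LY, closed LY & separable_subset LY],
      [/\ LX z0.1, LY z0.2 & LY z1.2] &
      forall i z l, LX z.1 -> LY z.2 -> Q i z l ->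
        exists l', Q i z l' /\ forall w, w \in l' -> LX w.1 /\ LY w.2].
Proof.
move=> Qopen.
(* The list must work on the whole ball of radius [m.+1%:R^-1] around d, so it can be used at any z
   in that ball. The default is the empty list. *)
pose witness (i : I) (m : nat) (d : X * Y) : seq (X * Y) :=
  xget [::] [set l | forall z, `|z - d| < m.+1%:R^-1 -> Q i z l].
pose op (j : rat + bool + (I * nat * nat)) (a b : X * Y) : X * Y :=
  match j with
  | inl (inl r) => ratr r *: a + b
  | inl (inr true) => (a.1, b.2)
  | inl (inr false) => z1
  | inr (i, m, k) => nth z0 (witness i m a) k
  end.
have [D [Dc Dz0 Dop]] := countable_algebraic_closure op z0.
have Dlin (r : rat) a b : D a -> D b -> D (ratr r *: a + b).
  exact: (Dop (inl (inl r))).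
have Dmix a b : D a -> D b -> D (a.1, b.2) by exact: (Dop (inl (inr true))).
have Dz1 : D z1 by exact: (Dop (inl (inr false)) _ _ Dz0 Dz0).
have D0 : D 0.
  by have := Dlin (-1) _ _ Dz0 Dz0; rewrite rmorphN rmorph1 scaleN1r addNr.
have DL w : D w -> closure (fst @` D) w.1 /\ closure (snd @` D) w.2.
  by move=> Dw; split; apply: subset_closure; exists w.
exists (closure (fst @` D)), (closure (snd @` D)); split.
- split; [|exact: closed_closure|].
    apply: closure_rat_subspace; first by exists 0.
    move=> r _ _ [a Da <-] [b Db <-].
    by exists (ratr r *: a + b) => //; exact: Dlin.
  exists (fst @` D); split=> //; last exact: subset_closure.
  exact: card_le_trans (card_image_le _ _) Dc.
- split; [|exact: closed_closure|].
    apply: closure_rat_subspace; first by exists 0.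
    move=> r _ _ [a Da <-] [b Db <-].
    by exists (ratr r *: a + b) => //; exact: Dlin.
  exists (snd @` D); split=> //; last exact: subset_closure.
  exact: card_le_trans (card_image_le _ _) Dc.
- by have [? ?] := DL _ Dz0; have [_ ?] := DL _ Dz1.
move=> i z l /closure_normP zX /closure_normP zY Qzl.
have [e e0 eQ] := Qopen _ _ _ Qzl.
(* Two radii below e / 2 add up: the ball around d lies within distance e of z. *)
have [|m me] := @exists_invn_lt _ (e / 2); first by rewrite divr_gt0.
have m0 : 0 < (m.+1%:R^-1 : R) by rewrite invr_gt0 ltr0Sn.
have [_ [a Da <-] za] := zX _ m0; have [_ [b Db <-] zb] := zY _ m0.
pose d := (a.1, b.2).
have zd : `|z - d| < m.+1%:R^-1 by rewrite prod_normE gt_max za zb.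
have wP z' : `|z' - d| < m.+1%:R^-1 -> Q i z' (witness i m d).
  rewrite /witness; case: xgetP => [l' _ /(_ z')//|/(_ l)[]].
  move=> z2 z2d; apply: eQ; apply: le_lt_trans (ler_distD d _ _) _.
  by rewrite (distrC d); move: z2d zd me; set t := _^-1; lra.
exists (witness i m d); split; first exact: wP.
move=> w /(nthP z0)[k _ <-]; apply: DL.
exact: (Dop (inr (i, m, k)) d d (Dmix _ _ Da Db) (Dmix _ _ Da Db)).
Qed.

End SeparableReduction.

(** * Frechet normals and finite obstructions to them *)

Lemma filter_forall_in_seq {T : eqType} {U : Type} {F : set_system U}
    {FF : Filter F} (P : T -> set U) (s : seq T) :
  (forall c, c \in s -> F (P c)) -> F [set u | forall c, c \in s -> P c u].
Proof.
elim: s => [|a s ih] h; first by apply: filterS filterT => u _ c.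
have h2 : F [set u | forall c, c \in s -> P c u].
  by apply: ih => c cs; apply: h; rewrite inE cs orbT.
apply: filterS2 (h a (mem_head _ _)) h2 => u ua us c.
by rewrite inE => /predU1P[->|/us].
Qed.

Section FrechetExtension.
Context {R : realType} {X Y : completeNormedModType R}.

(** The precisions [n.+1%:R^-1] determine the upper limit, so a Frechet normal is controlled by
    countably many moduli. *)
Lemma frechet_normal_intro (Om : set (X * Y)) (z : X * Y) (f : X * Y -> R) :
  dual f ->
  (forall n : nat, exists2 d : R, 0 < d & forall v, Om v -> `|v - z| < d ->
     f (v - z) <= `|v - z| / n.+1%:R) ->
  frechet_normal Om z f.
Proof.
move=> fd hf; split=> //; apply/lee_addgt0Pr => e e0; rewrite add0e.
have [n ne] := exists_invn_lt e0; have [d d0 hd] := hf n.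
pose A := [set v : X * Y | [/\ Om v, v != z & `|v - z| < d]].
apply: (@le_trans _ _ (ereal_sup
    [set (f (v - z) / `|v - z|)%:E | v in A])).
  apply: ereal_inf_lbound; exists A => //.
  apply/nbhs_ballP; exists d => // v; rewrite -ball_normE/= => zv vz Omv.
  by split=> //; rewrite distrC.
apply: ge_ereal_sup => _ [v [Omv vz vd] <-]; rewrite lee_fin.
have nv : 0 < `|v - z| by rewrite normr_gt0 subr_eq0.
rewrite ler_pdivrMr//; apply: le_trans (hd _ Omv vd) _.
by rewrite mulrC ler_pM2r// ltW.
Qed.

Variables (Om : set (X * Y)) (ybar : Y) (A B tau : R).
Hypotheses (A0 : 0 <= A) (B0 : 0 <= B).

Let S (w : X * Y) := A * `|w.1| + B * `|w.2|.

Let sublinearS : sublinear S.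
Proof.
split=> [u v|t v t0].
  have := ler_wpM2l A0 (ler_normD u.1 v.1).
  by have := ler_wpM2l B0 (ler_normD u.2 v.2); rewrite /S/=; lra.
by rewrite /S/= !normrZ ger0_norm//; ring.
Qed.

(** An item (c, n, v) stands for c times the constraint [f (v - z) <= |v - z| / n.+1%:R]; [comb] and
    [cost] sum the two sides. *)
Let comb (s : seq (R * nat * (X * Y))) (z : X * Y) : X * Y :=
  \sum_(c <- s) c.1.1 *: (c.2 - z).

Let cost (s : seq (R * nat * (X * Y))) (z : X * Y) : R :=
  \sum_(c <- s) c.1.1 * (`|c.2 - z| / c.1.2.+1%:R).

(** If f lies under S, meets the summed constraints and satisfies [f (0, z.2 - ybar) <= - (tau *
    |z.2 - ybar|)], then adding the inequalities gives a nonnegative gap. A negative gap is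
    therefore a contradiction. *)
Let gap (t : R) (s : seq (R * nat * (X * Y))) (z : X * Y) : R :=
  S (- (comb s z + (0, t *: (z.2 - ybar)))) + (cost s z - t * (tau * `|z.2 - ybar|)).

(* [d] is a finite prefix of moduli: the point of an item with precision n lies
   within (d_n + 1)^-1 of z. *)
Let admissible (d : seq nat) (s : seq (R * nat * (X * Y))) (z : X * Y) : Prop :=
  forall c, c \in s -> [/\ 0 <= c.1.1, (c.1.2 < size d)%N, Om c.2 &
                        `|c.2 - z| < (nth 0%N d c.1.2).+1%:R^-1].

(* By the Mazur-Orlicz theorem these are the finite certificates for the
   nonexistence of a Frechet normal at z with the given bounds and moduli. *)
Definition frechet_obstruction (d : seq nat) (z : X * Y) (l : seq (X * Y)) :=
  exists (t : R) (cs : seq (R * nat)),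
    [/\ 0 <= t, admissible d (zip cs l) z & gap t (zip cs l) z < 0].

(** With list and coefficients fixed, the gap is continuous in z and the distance conditions are
    strict; membership in Om concerns the points of the list alone. *)
Lemma frechet_obstruction_open d l z : frechet_obstruction d z l ->
  exists2 e : R, 0 < e & forall v, `|v - z| < e -> frechet_obstruction d v l.
Proof.
move=> [t [cs [t0 adm gap0]]]; set s := zip cs l in adm gap0.
have idz : (fun v : X * Y => v) @ z --> z by exact: cvg_id.
have combc : comb s v @[v --> z] --> comb s z.
  rewrite /comb; elim: (s) => [|c s' ih].
    by under eq_fun do rewrite big_nil; rewrite big_nil; exact: cvg_cst.
  under eq_fun do rewrite big_cons.
  rewrite big_cons; apply: cvgD => //; apply: cvgZ; first exact: cvg_cst.
  by apply: cvgB => //; exact: cvg_cst.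
have costc : cost s v @[v --> z] --> cost s z.
  rewrite /cost; elim: (s) => [|c s' ih].
    by under eq_fun do rewrite big_nil; rewrite big_nil; exact: cvg_cst.
  under eq_fun do rewrite big_cons.
  rewrite big_cons; apply: cvgD => //; apply: cvgM; first exact: cvg_cst.
  apply: cvgM; last exact: cvg_cst.
  by apply: cvg_norm; apply: cvgB => //; exact: cvg_cst.
have dc : v.2 - ybar @[v --> z] --> z.2 - ybar.
  by apply: cvgB; [exact: cvg_prod2|exact: cvg_cst].
have gapc : gap t s v @[v --> z] --> gap t s z.
  rewrite /gap /S/=; under eq_fun do rewrite !normrN; rewrite !normrN.
  apply: cvgD; last first.
    apply: cvgB => //; apply: cvgM; first exact: cvg_cst.
    by apply: cvgM; [exact: cvg_cst|exact: cvg_norm].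
  apply: cvgD; (apply: cvgM; first exact: cvg_cst); apply: cvg_norm; apply: cvgD.
  - exact: cvg_prod1.
  - exact: cvg_cst.
  - exact: cvg_prod2.
  - by apply: cvgZ => //; exact: cvg_cst.
have : \forall v \near z, frechet_obstruction d v l.
  have gapv : \forall v \near z, gap t s v < 0.
    exact: (cvgr_lt _ gapc _ gap0).
  have admv : \forall v \near z, forall c, c \in s ->
      `|c.2 - v| < (nth 0%N d c.1.2).+1%:R^-1.
    apply: (@filter_forall_in_seq _ _ (nbhs z) _ (fun c (v : X * Y) =>
      `|c.2 - v| < (nth 0%N d c.1.2).+1%:R^-1) s) => c /adm[_ _ _ cz].
    have cc : `|c.2 - v| @[v --> z] --> `|c.2 - z|.
      by apply: cvg_norm; apply: cvgB => //; exact: cvg_cst.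
    exact: (cvgr_lt _ cc _ cz).
  near=> v; exists t, cs; split=> //.
    move=> c cs'; have [c0 cd Omc _] := adm _ cs'; split=> //.
    by move: c cs' c0 cd Omc; near: v; apply: filterS admv => v hv c /hv.
  by near: v.
move=> /nbhs_ballP[e /= e0 eh]; exists e => // v vz; apply: eh.
by rewrite -ball_normE/= distrC.
Unshelve. all: by end_near. Qed.

Variables (z : X * Y) (delta : nat -> nat).

Lemma no_obstruction_functional :
  (forall k l, ~ frechet_obstruction (mkseq delta k) z l) ->
  exists f : X * Y -> R, [/\ linear (f : X * Y -> R^o),
    forall w, f w <= A * `|w.1| + B * `|w.2|,
    f (0, z.2 - ybar) <= - (tau * `|z.2 - ybar|) &
    forall n v, Om v -> `|v - z| < (delta n).+1%:R^-1 ->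
      f (v - z) <= `|v - z| / n.+1%:R].
Proof.
move=> hno.
pose adm (s : seq (R * nat * (X * Y))) := forall c, c \in s ->
  [/\ 0 <= c.1.1, Om c.2 & `|c.2 - z| < (delta c.1.2).+1%:R^-1].
pose C := [set c : X * Y * R | exists (t : R) s, [/\ 0 <= t, adm s &
  c = (comb s z + (0, t *: (z.2 - ybar)), cost s z - t * (tau * `|z.2 - ybar|))]].
have hC : convex_cone C.
  split.
  - exists 0, [::]; split=> //.
    by rewrite /comb /cost !big_nil mul0r subr0 scale0r addr0.
  - move=> _ _ [t [s [t0 adms ->]]] [t' [s' [t'0 adms' ->]]].
    exists (t + t'), (s ++ s'); split; first exact: addr_ge0.
      by move=> c; rewrite mem_cat => /orP[/adms|/adms'].
    rewrite /comb /cost !big_cat/=; congr (_, _) => /=; last by ring.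
    rewrite addrACA; congr (_ + _); rewrite -[LHS]/(_, _)/=.
    by rewrite addr0 scalerDl.
  - move=> a _ a0 [t [s [t0 adms ->]]].
    exists (a * t), [seq (a * c.1.1, c.1.2, c.2) | c <- s]; split.
    + exact: mulr_ge0.
    + move=> _ /mapP[c /adms[c0 Omc cz] ->] /=; split=> //; exact: mulr_ge0.
    + rewrite /comb /cost !big_map /= scalerDr scaler_sumr.
      congr (_, _).
        congr (_ + _); first by apply: eq_bigr => c _; rewrite scalerA.
        by rewrite -[LHS]/(_, _)/= scaler0 scalerA.
      rewrite mulrBr mulr_sumr; congr (_ - _); last by ring.
      by apply: eq_bigr => c _; rewrite mulrA.
have hCS c : C c -> 0 <= S (- c.1) + c.2.
  case=> t [s [t0 adms ->]]; rewrite leNgt; apply/negP => neg.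
  (* A violation of compatibility involves finitely many items, so a prefix of moduli longer than
     all their precisions suffices. *)
  pose k := (\max_(c <- s) c.1.2).+1.
  apply: (hno k (unzip2 s)); exists t, (unzip1 s); rewrite zip_unzip; split=> //.
  move=> b bs; have [b0 Omb bz] := adms _ bs.
  have bk : (b.1.2 < k)%N by rewrite ltnS; exact: leq_bigmax_seq.
  by rewrite size_mkseq nth_mkseq.
have [f [flin fS fC]] := mazur_orlicz sublinearS hC hCS.
exists f; split=> // [|n v Omv vz].
  have /fC : C ((0, z.2 - ybar), - (tau * `|z.2 - ybar|)) => //.
  exists 1, [::]; split=> //.
  by rewrite /comb /cost !big_nil scale1r mul1r !add0r.
have /fC : C (v - z, `|v - z| / n.+1%:R) => //.
exists 0, [:: (1, n, v)]; split=> // [c|]; first by rewrite inE => /eqP ->.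
rewrite /comb /cost !big_seq1/= !scale1r mul1r mul0r subr0 scale0r.
by rewrite addr0.
Qed.

(** The converse, localized: inequalities on [Om] within L and below precision k already exclude
    obstructions whose points lie in L. *)
Lemma functional_no_obstruction (L : set (X * Y)) (k : nat) (f : X * Y -> R) :
  linear (f : X * Y -> R^o) -> (forall w, f w <= A * `|w.1| + B * `|w.2|) ->
  f (0, z.2 - ybar) <= - (tau * `|z.2 - ybar|) ->
  (forall n v, (n < k)%N -> Om v -> L v -> `|v - z| < (delta n).+1%:R^-1 ->
     f (v - z) <= `|v - z| / n.+1%:R) ->
  forall l, (forall w, w \in l -> L w) ->
    ~ frechet_obstruction (mkseq delta k) z l.
Proof.
move=> flin fS fy fn l lL [t [cs [t0 adm]]]; apply/negP; rewrite -leNgt.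
set s := zip cs l in adm *.
have sL c : c \in s -> L c.2.
  move=> cs'; apply: lL; move: cs'; rewrite /s => /(map_f snd).
  elim: (cs) (l) => [|a cs1 ih] [|b l1]//=; rewrite !inE => /predU1P[->|/ih ->].
    by rewrite eqxx.
  by rewrite orbT.
have fcomb : f (comb s z) <= cost s z.
  have : forall c, c \in s -> c \in s by [].
  rewrite /comb /cost; move: {-2}s => s1; elim: s1 => [|c s1 ih] sub.
    by rewrite !big_nil (functional0 flin).
  rewrite !big_cons (functionalD flin) (functionalZ flin) lerD//; last first.
    by apply: ih => c' c's; apply: sub; rewrite inE c's orbT.
  have cs1 : c \in s by apply: sub; rewrite mem_head.
  have [c0] := adm _ cs1; rewrite size_mkseq => ck Omc; rewrite nth_mkseq// => cz.
  by rewrite ler_wpM2l//; apply: fn => //; exact: sL.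
have := fS (- (comb s z + (0, t *: (z.2 - ybar)))).
rewrite /gap -/(S _) (functionalN flin) (functionalD flin).
have -> : (0, t *: (z.2 - ybar)) = t *: (0, z.2 - ybar) :> X * Y.
  by rewrite -[RHS]/(_, _)/= scaler0.
rewrite (functionalZ flin); have := ler_wpM2l t0 fy; move: fcomb; lra.
Qed.

End FrechetExtension.

(** * Superdifferentials along a subspace and the fuzzy multiplier rule *)

Section Superdifferential.
Context {R : realType} {V : normedModType R}.
Variable L : set V.

Definition superdiff (phi : V -> R) (z : V) (f : V -> R) : Prop :=
  forall t : R, 0 < t -> exists2 d : R, 0 < d &
    forall w, L w -> `|w| < d -> phi (z + w) <= phi z + f w + t * `|w|.

Lemma superdiffD phi psi z f g : superdiff phi z f -> superdiff psi z g ->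
  superdiff (fun v => phi v + psi v) z (fun w => f w + g w).
Proof.
move=> hf hg t t0; have t20 : 0 < t / 2 by rewrite divr_gt0.
have [d d0 hd] := hf _ t20; have [e e0 he] := hg _ t20.
exists (Num.min d e) => [|w Lw]; rewrite lt_min ?d0// => /andP[wd we].
by have := hd w Lw wd; have := he w Lw we; lra.
Qed.

Lemma superdiffZ (c : R) phi z f : 0 < c -> superdiff phi z f ->
  superdiff (fun v => c * phi v) z (fun w => c * f w).
Proof.
move=> c0 hf t t0; have [d d0 hd] := hf _ (divr_gt0 t0 c0).
exists d => // w Lw wd; have := hd w Lw wd; rewrite -(ler_pM2l c0).
by rewrite !mulrDr mulrA (mulrC c (t / c)) divfK// gt_eqF.
Qed.

Lemma superdiff_shift phi z a f : superdiff phi (z - a) f ->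
  superdiff (fun v => phi (v - a)) z f.
Proof.
move=> hf t t0; have [d d0 hd] := hf _ t0; exists d => // w Lw wd.
by rewrite addrAC; exact: hd.
Qed.

End Superdifferential.

Section FuzzyMultiplier.
Context {R : realType}.

Local Notation h := (GRing.exp (2^-1 : R)).

Lemma asplund_penalty (V : completeNormedModType R) (L : set V) :
  asplund V -> linear_subspace L -> separable_subset L ->
  forall s : R, 0 < s -> exists q : V -> R,
  [/\ q 0 = 0, forall x, `|x| - s <= q x, forall x y, q x - q y <= `|x - y| &
    forall x, exists f, [/\ unit_functional f, q x - s <= f x &
                            superdiff L q x f]].
Proof.
move=> aV Lsub Lsep s s0; have [e [e1 ed]] := asplund_dense_sequence aV Lsub Lsep.
have s80 : 0 < s / 8 by rewrite divr_gt0.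
have [q] := exists_smooth_penalty Lsub.1 e1 ed s80.
by rewrite divfK// => ?; exists q.
Qed.

Variables X Y : completeNormedModType R.

Lemma superdiff_fst (LX : set X) (LY : set Y) (p : X -> R) (z : X * Y) f :
  superdiff LX p z.1 f ->
  superdiff [set w : X * Y | LX w.1 /\ LY w.2] (fun w => p w.1) z (fun w => f w.1).
Proof.
move=> hf t t0; have [d d0 hd] := hf _ t0; exists d => // w [Lw _] wd.
have [w1 _] := prod_norm_ge w; apply: le_trans (hd _ Lw (le_lt_trans w1 wd)) _.
by rewrite lerD2l ler_wpM2l// ltW.
Qed.

Lemma superdiff_snd (LX : set X) (LY : set Y) (p : Y -> R) (z : X * Y) f :
  superdiff LY p z.2 f ->
  superdiff [set w : X * Y | LX w.1 /\ LY w.2] (fun w => p w.2) z (fun w => f w.2).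
Proof.
move=> hf t t0; have [d d0 hd] := hf _ t0; exists d => // w [_ Lw] wd.
have [_ w2] := prod_norm_ge w; apply: le_trans (hd _ Lw (le_lt_trans w2 wd)) _.
by rewrite lerD2l ler_wpM2l// ltW.
Qed.

Lemma closed_prod_subset (LX : set X) (LY : set Y) : closed LX -> closed LY ->
  closed [set w : X * Y | LX w.1 /\ LY w.2].
Proof.
move=> cX cY w hw; split.
- apply/cX/closure_normP => e e0.
  have /closure_normP/(_ _ e0)[v [LXv _] wv] := hw.
  by exists v.1 => //; have [/le_lt_trans-> //] := prod_norm_ge (w - v).
- apply/cY/closure_normP => e e0.
  have /closure_normP/(_ _ e0)[v [_ LYv] wv] := hw.
  by exists v.2 => //; have [_ /le_lt_trans-> //] := prod_norm_ge (w - v).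
Qed.

(** The Frechet counterpart of [clarke_multiplier], at a nearby point. The functionals found along
    the separable subspace only exclude obstructions; the normal itself is then produced on the
    whole space by [no_obstruction_functional]. *)
Theorem fuzzy_multiplier (Om : set (X * Y)) (zh : X * Y) (ybar : Y)
    (a g k r : R) :
  asplund X -> asplund Y -> closed Om -> Om zh -> zh.2 != ybar ->
  0 <= a -> 0 < g -> 0 < k -> 0 < r ->
  (forall v, Om v -> `|zh.2 - ybar| <= `|v.2 - ybar| + a * weighted_norm g (v - zh)) ->
  exists (z : X * Y) (xs : X -> R) (vs : Y -> R),
    [/\ Om z /\ `|z - zh| <= r, linear (xs : X -> R^o) /\ linear (vs : Y -> R^o),
        (forall u, `|xs u| <= (a + k) * `|u|) /\
        (forall v, `|vs v| <= (1 + (a + k) * g) * `|v|),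
        (1 - k - (a + k) * g) * `|z.2 - ybar| <= vs (z.2 - ybar) &
        frechet_normal Om z (fun w => xs w.1 - vs w.2)].
Proof.
move=> aX aY Omc Omzh zhy a0 g0 k0 r0 hmin.
pose A := a + k; pose B := 1 + A * g; pose tau := 1 - k - A * g.
have A0 : 0 <= A by rewrite addr_ge0// ltW.
have Ag0 : 0 <= A * g by rewrite mulr_ge0// ltW.
have B0 : 0 <= B by rewrite addr_ge0.
have [LX [LY [[LXs LXc LXsep] [LYs LYc LYsep] [zh1 zh2 yb] red]]] :=
  separable_reduction (Q := frechet_obstruction Om ybar A B tau) zh (0, ybar)
    (fun d l z => @frechet_obstruction_open _ _ _ Om ybar A B tau d l z).
pose LL := [set w : X * Y | LX w.1 /\ LY w.2].
have LLB u v : LL u -> LL v -> LL (u - v).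
  by move=> [u1 u2] [v1 v2]; split; rewrite /= addrC -scaleN1r;
    [exact: LXs.2|exact: LYs.2].
pose N := @weighted_norm R X Y g; pose K := 1 + g + g^-1.
have K0 : 0 < K := weighted_const_gt0 g0.
pose rho := `|zh.2 - ybar|.
have rho0 : 0 < rho by rewrite normr_gt0 subr_eq0.
(* The bound r keeps the new point near [zh]; rho / 2 keeps its second component away from
   [ybar]. *)
pose r1 := Num.min r (rho / 2) / K.
have r10 : 0 < r1 by rewrite divr_gt0// lt_min r0 divr_gt0.
have Kr1 : K * r1 = Num.min r (rho / 2) by rewrite mulrC divfK// gt_eqF.
have ag0 : 0 < 1 + a * (1 + g).
  by rewrite ltr_pwDl// mulr_ge0// addr_ge0// ltW.
(* The first bound limits the loss from smoothing the norms to the admissible initial error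
   [k * r1 / 8]; the second makes [2 * E] at most [k * |zi.2 - ybar|], which is the k in [tau]. *)
pose E := Num.min (k * r1 / 8 / (1 + a * (1 + g))) (k * rho / 4).
have E0 : 0 < E.
  by rewrite lt_min; apply/andP; split; rewrite ?divr_gt0// mulr_gt0.
have E1 : E * (1 + a * (1 + g)) <= k * r1 / 8.
  by rewrite -ler_pdivlMr// ge_min lexx.
have E2 : E <= k * rho / 4 by rewrite ge_min lexx orbT.
have [bX [bX0 bXge bXlip bXd]] := asplund_penalty aX LXs LXsep E0.
have [bY [bY0 bYge bYlip bYd]] := asplund_penalty aY LYs LYsep E0.
have g1 : 0 < 1 + g by rewrite addr_gt0.
(* [q n] combines two penalties with weights 1 and g, so their total error is [(1 + g) * En n]. *)
pose En n := r1 * h n / 8 / (1 + g).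
have En0 n : 0 < En n by rewrite !divr_gt0// mulr_gt0// exprn_gt0.
have /choice[pX pXP] n := asplund_penalty aX LXs LXsep (En0 n).
have /choice[pY pYP] n := asplund_penalty aY LYs LYsep (En0 n).
pose q n (w : X * Y) := pX n w.1 + g * pY n w.2.
pose phi0 (v : X * Y) := bY (v.2 - ybar) +
  a * (bX (v.1 - zh.1) + g * bY (v.2 - zh.2)).
pose Om' := Om `&` LL.
have q0 n : q n 0 = 0.
  have [pX0 _ _ _] := pXP n; have [pY0 _ _ _] := pYP n.
  by rewrite /q pX0 pY0 mulr0 addr0.
have q_ge n v : N v - r1 * h n / 8 <= q n v.
  have [_ pXge _ _] := pXP n; have [_ pYge _ _] := pYP n.
  have -> : r1 * h n / 8 = (1 + g) * En n by rewrite /En [RHS]mulrC divfK// gt_eqF.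
  have := pXge v.1; have := ler_wpM2l (ltW g0) (pYge v.2).
  by rewrite /q /N /weighted_norm; lra.
have q_lip n u v : q n u - q n v <= N (u - v).
  have [_ _ pXl _] := pXP n; have [_ _ pYl _] := pYP n.
  have := pXl u.1 v.1; have := ler_wpM2l (ltW g0) (pYl u.2 v.2).
  by rewrite /q /N /weighted_norm/=; lra.
have phi0c : continuous phi0.
  apply: (@lipschitz_continuous _ _ _ (1 + a * (1 + g))) => u v.
  have [n1 n2] := prod_norm_ge (u - v).
  have h1 := bYlip (u.2 - ybar) (v.2 - ybar).
  have h2 := bXlip (u.1 - zh.1) (v.1 - zh.1).
  have h3 := bYlip (u.2 - zh.2) (v.2 - zh.2).
  have ee (W : zmodType) (x y c : W) : x - c - (y - c) = x - y.
    by rewrite opprB addrA subrK.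
  rewrite !ee in h1 h2 h3.
  have h3' := ler_wpM2l (ltW g0) (le_trans h3 n2).
  have : a * (bX (u.1 - zh.1) - bX (v.1 - zh.1) +
      g * (bY (u.2 - zh.2) - bY (v.2 - zh.2))) <= a * ((1 + g) * `|u - v|).
    by rewrite ler_wpM2l//; have := le_trans h2 n1; move: h3'; clear; lra.
  by have := le_trans h1 n2; rewrite /phi0; clear; lra.
have phi0min v : Om' v -> phi0 zh <= phi0 v + k * r1 / 8.
  move=> [Omv _]; have := hmin _ Omv; rewrite /phi0 !subrr bX0 bY0 mulr0 addr0 mulr0.
  have := bYlip (zh.2 - ybar) 0; rewrite subr0 bY0 subr0.
  have := bYge (v.2 - ybar).
  have : a * (N (v - zh) - (1 + g) * E) <=
         a * (bX (v.1 - zh.1) + g * bY (v.2 - zh.2)).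
    rewrite ler_wpM2l//; have := bXge (v.1 - zh.1).
    by have := ler_wpM2l (ltW g0) (bYge (v.2 - zh.2)); rewrite /N /weighted_norm/=; lra.
  by move: E1; rewrite /N addr0; lra.
have [zs [phi [zi [phi0E phiS [Omzi LLzi] Nzi zimin]]]] :=
  smooth_variational_principle (@prod_complete R X Y) K0 (weighted_normD g0)
    (weighted_norm_le g0) (weighted_norm_ge g0)
    k0 r10 q0 q_ge q_lip (closedI Omc (closed_prod_subset LXc LYc))
    (conj Omzh (conj zh1 zh2)) phi0c phi0min.
have zizh : `|zi - zh| <= Num.min r (rho / 2).
  by apply: le_trans (weighted_norm_ge g0 _) _; rewrite -Kr1 ler_pM2l.
have [zir zirho] : `|zi - zh| <= r /\ `|zi - zh| <= rho / 2.
  by move: zizh; rewrite le_min => /andP[].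
have yrho : rho / 2 <= `|zi.2 - ybar|.
  have [_ n2] := prod_norm_ge (zi - zh).
  have := ler_distD zi.2 zh.2 ybar; rewrite -/rho (distrC zh.2).
  by have := le_trans n2 zirho; clear; rewrite /=; lra.
have [f1 [[f1l f1b] f1ge f1d]] := bYd (zi.2 - ybar).
have [f2 [[f2l f2b] _ f2d]] := bXd (zi.1 - zh.1).
have [f3 [[f3l f3b] _ f3d]] := bYd (zi.2 - zh.2).
have /choice[fX fXP] n : exists f, unit_functional f /\
    superdiff LX (pX n) (zi - zs n).1 f.
  have [_ _ _ /(_ (zi - zs n).1)[f [f1' _ fd]]] := pXP n.
  by exists f.
have /choice[fY fYP] n : exists f, unit_functional f /\
    superdiff LY (pY n) (zi - zs n).2 f.
  have [_ _ _ /(_ (zi - zs n).2)[f [f1' _ fd]]] := pYP n.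
  by exists f.
(* [zeta n] collects the superderivatives at [zi] of all terms of [phi n] except [bY (v.2 - ybar)],
   whose superderivative is [f1]. *)
pose zeta := fix zeta n : X * Y -> R := if n is m.+1
  then fun w => zeta m w + k * h m.+1 * (fX m w.1 + g * fY m w.2)
  else fun w => a * (f2 w.1 + g * f3 w.2).
pose xi n (w : X * Y) := f1 w.2 + zeta n w.
have zetaS n w : zeta n.+1 w = zeta n w + k * h n.+1 * (fX n w.1 + g * fY n w.2).
  by [].
have hS n : h n.+1 = h n / 2 by rewrite exprSr.
have h_gt0 n : 0 < h n by rewrite exprn_gt0.
have zeta_lin n : linear (zeta n : X * Y -> R^o).
  elim: n => [|n ih] b u v.
    by rewrite /= f2l f3l /GRing.scale/=; ring.
  rewrite !zetaS ih /= (fXP n).1.1 (fYP n).1.1 /GRing.scale/=; ring.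
have step n w : `|k * h n.+1 * (fX n w.1 + g * fY n w.2)| <= k * h n.+1 * N w.
  have kh0 : 0 < k * h n.+1 by rewrite mulr_gt0.
  rewrite normrM (gtr0_norm kh0) ler_pM2l//; apply: le_trans (ler_normD _ _) _.
  rewrite normrM (gtr0_norm g0) lerD ?(fXP n).1.2//.
  by rewrite ler_pM2l// (fYP n).1.2.
have zeta_tail n m w : `|zeta (n + m)%N w - zeta n w| <= k * (h n - h (n + m)%N) * N w.
  elim: m => [|m ih]; first by rewrite addn0 !subrr normr0 mulr0 mul0r.
  rewrite addnS zetaS addrAC.
  apply: le_trans (ler_normD _ _) _; apply: le_trans (lerD ih (step _ w)) _.
  by rewrite hS; clear; lra.
have zeta_le n w : `|zeta n w| <= A * N w.
  have := zeta_tail 0%N n w; rewrite add0n expr0.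
  have N0 : 0 <= k * h n * N w.
    by rewrite mulr_ge0 ?mulr_ge0 ?(ltW k0) ?(ltW (h_gt0 _))// addr_ge0// mulr_ge0// ltW.
  have : `|zeta 0%N w| <= a * N w.
    rewrite /= normrM (ger0_norm a0) ler_wpM2l//.
    apply: le_trans (ler_normD _ _) _; rewrite normrM (gtr0_norm g0) lerD//.
    by rewrite ler_pM2l.
  have := ler_distD 0 (zeta n w) (zeta 0%N w).
  have := ler_normD (zeta n w - zeta 0%N w) (zeta 0%N w); rewrite subrK /A.
  by move: N0; clear; lra.
have xi_d n : superdiff LL (phi n) zi (xi n).
  elim: n => [|n ih].
    rewrite phi0E; apply: superdiffD.
      exact: (@superdiff_snd LX LY (fun y => bY (y - ybar)) _ _ (superdiff_shift f1d)).
    have [a00|a_neq0] := eqVneq a 0.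
      move=> t t0; exists 1 => // w _ _.
      by rewrite /= a00 !mul0r !add0r mulr_ge0// ltW.
    apply: superdiffZ; first by rewrite lt_neqAle eq_sym a_neq0.
    apply: superdiffD.
      exact: (@superdiff_fst LX LY (fun x => bX (x - zh.1)) _ _ (superdiff_shift f2d)).
    apply: superdiffZ => //.
    exact: (@superdiff_snd LX LY (fun y => bY (y - zh.2)) _ _ (superdiff_shift f3d)).
  have -> : phi n.+1 = fun v => phi n v + k * h n.+1 * q n (v - zs n).
    by apply/funext => v; exact: phiS.
  have -> : xi n.+1 = fun w => xi n w + k * h n.+1 * (fX n w.1 + g * fY n w.2).
    by apply/funext => w; rewrite /xi zetaS addrA.
  apply: superdiffD => //; apply: superdiffZ; first by rewrite mulr_gt0.
  apply: superdiff_shift; apply: superdiffD.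
    exact: (superdiff_fst _ (fXP n).2).
  by apply: superdiffZ => //; exact: (superdiff_snd _ (fYP n).2).
have moduli n : exists dM : nat * nat, forall m v, (dM.2 <= m)%N -> Om v -> LL v ->
    `|v - zi| < dM.1.+1%:R^-1 -> - xi m (v - zi) <= `|v - zi| / n.+1%:R.
  (* Three errors of at most [t * |v - zi|] arise: from the superdifferential, from near minimality
     at stage M and from the tail of [zeta]. Since the tail is bounded for all m >= M, one radius
     serves all these stages. *)
  pose t : R := n.+1%:R^-1 / 4.
  have t0 : 0 < t by rewrite divr_gt0// invr_gt0 ltr0Sn.
  have hcvg : h M @[M --> \oo] --> 0.
    by apply: cvg_expr; rewrite ger0_norm ?invr_ge0// invf_lt1// ltr1n.
  have [M _ /(_ M (leqnn M))/= hM] :=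
    cvgr_lt _ hcvg _ (divr_gt0 t0 (mulr_gt0 k0 K0)).
  rewrite ltr_pdivlMr ?mulr_gt0// in hM.
  have [d d0 hd] := xi_d M _ t0; have [e ed] := exists_invn_lt d0.
  exists (e, M) => m v /= Mm Omv LLv vz.
  have LLw : LL (v - zi) by exact: LLB.
  have := hd _ LLw (lt_trans vz ed); rewrite subrKC => hd'.
  have zm := zimin M v (conj Omv LLv); rewrite -/(N _) in zm.
  have NK := weighted_norm_le g0 (v - zi); rewrite -/N -/K in NK.
  have kN : k * h M * N (v - zi) <= t * `|v - zi|.
    apply: (@le_trans _ _ (k * h M * (K * `|v - zi|))).
      by rewrite ler_pM2l// mulr_gt0.
    have := ler_wpM2r (normr_ge0 (v - zi)) (ltW hM); clear; lra.
  have tail := zeta_tail M (m - M)%N (v - zi); rewrite subnKC// in tail.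
  have N0 : 0 <= k * h m * N (v - zi).
    by rewrite mulr_ge0 ?mulr_ge0 ?(ltW k0) ?(ltW (h_gt0 _))// addr_ge0// mulr_ge0// ltW.
  have := ler_norm (- (zeta m (v - zi) - zeta M (v - zi))); rewrite normrN.
  have -> : `|v - zi| / n.+1%:R = 4 * (t * `|v - zi|).
    by rewrite /t; set u := n.+1%:R^-1; field.
  have : 0 <= t * `|v - zi| by rewrite mulr_ge0// ltW.
  by move: hd' zm kN tail N0; rewrite /xi; clear; lra.
have /choice[dM dMP] := moduli.
pose delta n := (dM n).1.
have y_bound n : - xi n (0, zi.2 - ybar) <= - (tau * `|zi.2 - ybar|).
  have zl := zeta_le n (0, zi.2 - ybar).
  rewrite /N /weighted_norm/= normr0 add0r in zl.
  have := ler_norm (- zeta n (0, zi.2 - ybar)); rewrite normrN.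
  have : k * (rho / 2) <= k * `|zi.2 - ybar| by rewrite ler_pM2l.
  by move: f1ge (bYge (zi.2 - ybar)) E2 zl; rewrite /xi /tau/=; clear; lra.
have noobs m l : ~ frechet_obstruction Om ybar A B tau (mkseq delta m) zi l.
  move=> /(red _ _ _ LLzi.1 LLzi.2)[l' [obs l'L]].
  (* Beyond all thresholds of precisions below m, so the single functional [- xi M] obeys the first
     m moduli. *)
  pose M := (\max_(n < m) (dM n).2)%N.
  apply: (@functional_no_obstruction _ _ _ Om ybar A B tau zi delta LL m
    (fun w => - xi M w) _ _ (y_bound M) _ l' l'L obs).
  - move=> b u v; rewrite /xi/= f1l zeta_lin /GRing.scale/=; ring.
  - move=> w; have := zeta_le M w; have := ler_norm (- zeta M w).
    have := ler_norm (- f1 w.2); have := f1b w.2.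
    by rewrite !normrN /xi /N /weighted_norm /B; clear; lra.
  - move=> n v nm Omv LLv vz; apply: (dMP n) => //.
    exact: (leq_bigmax (Ordinal nm)).
have [f [fl fS fy fn]] := no_obstruction_functional A0 B0 noobs.
have fD u v : f (u, v) = f (u, 0) + f (0, v).
  by rewrite -(functionalD fl); congr f; rewrite -[RHS]/(_, _)/= addr0 add0r.
pose xs u := f (u, 0); pose vs v := - f (0, v).
have xsl : linear (xs : X -> R^o).
  move=> b u v; rewrite /xs -fl; congr f.
  by rewrite -[RHS]/(_, _)/= scaler0 addr0.
have vsl : linear (vs : Y -> R^o).
  move=> b u v; rewrite /vs scalerN -opprD -fl; congr (- f _).
  by rewrite -[RHS]/(_, _)/= scaler0 addr0.
have xsb u : `|xs u| <= A * `|u|.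
  apply: functional_abs_le => // {}u.
  by have := fS (u, 0); rewrite /= normr0 mulr0 addr0.
have vsb v : `|vs v| <= B * `|v|.
  apply: functional_abs_le => // {}v.
  have := fS (- (0, v)); rewrite (functionalN fl) /=.
  by rewrite oppr0 normr0 mulr0 add0r normrN.
have fE : (fun w : X * Y => xs w.1 - vs w.2) = f.
  by apply/funext => -[u v]; rewrite /xs /vs/= opprK -fD.
exists zi, xs, vs; split=> //.
  by rewrite /vs lerNr.
rewrite fE; apply: frechet_normal_intro.
  apply: (@bounded_dual _ _ _ (A + B)) => // w.
  have [w1 w2] := prod_norm_ge w; have := xsb w.1; have := vsb w.2.
  have := ler_wpM2l A0 w1; have := ler_wpM2l B0 w2.
  by rewrite -fE; have := ler_normB (xs w.1) (vs w.2); clear; lra.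
move=> n; exists (delta n).+1%:R^-1; first by rewrite invr_gt0 ltr0Sn.
by move=> v Omv vz; exact: fn.
Qed.

End FuzzyMultiplier.

(** * Normalization of functionals *)

Section DualNorm.
Context {R : realType} {V : normedModType R}.

Lemma dual_norm_bound (f : V -> R) (c : R) : linear (f : V -> R^o) ->
  (dual_norm f <= c%:E)%E -> forall v, `|f v| <= c * `|v|.
Proof.
move=> fl fc v; have [->|v0] := eqVneq v 0.
  by rewrite (functional0 fl) !normr0 mulr0.
have nv : 0 < `|v| by rewrite normr_gt0.
rewrite -ler_pdivrMr// -lee_fin; apply: le_trans fc.
have [fv|fv] := leP 0 (f v).
  by apply: (@dual_norm_ge _ _ _ v) => //; rewrite divfK ?gt_eqF// ger0_norm.
apply: (@dual_norm_ge _ _ _ (- v)); rewrite ?oppr_eq0//.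
by rewrite normrN divfK ?gt_eqF// (functionalN fl) ltr0_norm.
Qed.

(** Dividing f by its norm n, which lies between 1 - s and 1 + s, moves it by [|n - 1| <= s]. *)
Lemma dual_normalize (f : V -> R) (c s : R) (v : V) :
  linear (f : V -> R^o) -> 0 < s < 1 -> v != 0 ->
  (forall w, `|f w| <= (1 + s) * `|w|) -> (1 - s) * `|v| <= f v ->
  exists fs : V -> R, [/\ dual fs, dual_norm fs = 1%E,
    (1 - s) / (1 + s) * `|v| <= fs v & (dual_norm (f \- fs)%R <= s%:E)%E].
Proof.
move=> fl /andP[s0 s1] v0 fb fv.
have s10 : 0 <= 1 + s by rewrite addr_ge0// ltW.
have h1 : (dual_norm f <= (1 + s)%:E)%E by exact: dual_norm_le.
have h2 : ((1 - s)%:E <= dual_norm f)%E by exact: (dual_norm_ge _ v0).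
have [n nE] : exists n : R, dual_norm f = n%:E.
  by case: (dual_norm f) h1 h2 => [n| |]// _ _; exists n.
rewrite nE !lee_fin in h1 h2; have n0 : 0 < n by lra.
have fn : forall w, `|f w| <= n * `|w|.
  by apply: dual_norm_bound => //; rewrite nE.
pose fs w := n^-1 * f w.
have fsl : linear (fs : V -> R^o).
  by move=> a u w; rewrite /fs fl /GRing.scale/=; ring.
have fs1 w : `|fs w| <= 1 * `|w|.
  by rewrite /fs normrM (gtr0_norm (_ : 0 < n^-1)) ?invr_gt0// mul1r ler_pdivrMl.
exists fs; split.
- exact: bounded_dual fs1.
- apply/le_anti/andP; split; first exact: dual_norm_le.
  rewrite leNgt; apply/negP => lt1.
  have [m mE] : exists m : R, dual_norm fs = m%:E.
    have : (0 <= dual_norm fs)%E.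
      apply: (@dual_norm_ge _ _ _ v 0) => //; rewrite mul0r.
      rewrite /fs mulr_ge0 ?invr_ge0 ?ltW//; apply: lt_le_trans fv.
      by rewrite mulr_gt0 ?normr_gt0// subr_gt0.
    by case: (dual_norm fs) lt1 => [m| |]// _ _; exists m.
  have fm : forall w, `|fs w| <= m * `|w|.
    by apply: dual_norm_bound => //; rewrite mE.
  rewrite mE lte_fin in lt1.
  have m0 : 0 <= m.
    by have := le_trans (normr_ge0 _) (fm v); rewrite pmulr_lge0 ?normr_gt0.
  have : (dual_norm f <= (n * m)%:E)%E.
    apply: dual_norm_le => [|w]; first by rewrite mulr_ge0// ltW.
    have := fm w; rewrite /fs normrM (gtr0_norm (_ : 0 < n^-1)) ?invr_gt0//.
    by rewrite ler_pdivrMl// mulrA.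
  by rewrite nE lee_fin; apply/negP; rewrite -ltNge gtr_pMr.
- apply: (@le_trans _ _ ((1 - s) / n * `|v|)).
    rewrite ler_wpM2r// ler_pM2l ?subr_gt0// lef_pV2 ?posrE//; lra.
  by rewrite /fs mulrAC mulrC ler_pM2l ?invr_gt0.
- apply: dual_norm_le => [|w]; first exact: ltW.
  have -> : (f \- fs)%R w = (1 - n^-1) * f w by rewrite /fs/=; ring.
  rewrite normrM; apply: le_trans (ler_wpM2l (normr_ge0 _) (fn w)) _.
  rewrite mulrA ler_wpM2r// -{2}(gtr0_norm n0) -normrM.
  by rewrite mulrBl mul1r mulVf ?gt_eqF// ler_norml; apply/andP; split; lra.
Qed.

End DualNorm.

(** * From a violation of subregularity to a contradiction *)

Section SubregularityViolation.
Context {R : realType} {X Y : completeNormedModType R}.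

(** Provides a finite radius even if m is infinite, and a slope strictly below alpha, leaving room
    for later perturbations. *)
Lemma exists_slope_radius (r alpha : R) (m : \bar R) :
  0 <= r -> 0 < alpha -> (r%:E < alpha%:E * m)%E ->
  exists a mu : R, [/\ 0 < a < alpha, r < a * mu & (mu%:E <= m)%E].
Proof.
move=> r0 al0; case: m => [m| |] hm.
- rewrite -EFinM lte_fin in hm.
  have m0 : 0 < m by have := le_lt_trans r0 hm; rewrite pmulr_rgt0.
  have rm : r / m < alpha by rewrite ltr_pdivrMr.
  have rm0 : 0 <= r / m by rewrite divr_ge0// ltW.
  exists ((r / m + alpha) / 2), m; split=> //; first by apply/andP; split; lra.
  have : r / m * m = r by rewrite divfK// gt_eqF.
  by move: hm; nra.
- exists (alpha / 2), ((r + 1) / (alpha / 2)); split; last exact: leey.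
    by apply/andP; split; lra.
  by rewrite mulrC divfK ?gt_eqF ?divr_gt0// ltrDl.
- by move: hm; rewrite gt0_muleNy ?lte_fin// ltNge leNye.
Qed.

(** The slope and the radius are fixed before g, because g is chosen in terms of the slope. *)
Lemma violation_ekeland_points (Phi : X -> set Y) (xbar x : X) (ybar : Y)
    (alpha : R) (delta mu : \bar R) :
  closed (gph Phi) -> 0 < alpha -> eball xbar delta x ->
  (edist_inf (Phi x) ybar < alpha%:E * mu)%E ->
  (edist_inf (Phi x) ybar < alpha%:E * edist_inf (preimg Phi ybar) x)%E ->
  exists a mu1 : R, [/\ 0 < a < alpha,
    forall u y, `|u - x| < mu1 -> `|y - ybar| < alpha * mu1 ->
      [/\ eball xbar (delta + mu)%E u, ~ preimg Phi ybar u &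
          eball ybar (alpha%:E * mu)%E y] &
    forall g, 0 < g -> exists z, [/\ gph Phi z, `|z.1 - x| < mu1,
      `|z.2 - ybar| < alpha * mu1 &
      forall v, gph Phi v ->
        `|z.2 - ybar| <= `|v.2 - ybar| + a * weighted_norm g (v - z)]].
Proof.
(* The radius is at most mu, to remain in the prescribed balls, and at most the distance from x to
   the solution set, to avoid that set. *)
move=> Pc al0 xd dmu dpre; pose m := Order.min mu (edist_inf (preimg Phi ybar) x).
have : (edist_inf (Phi x) ybar < alpha%:E * m)%E.
  by rewrite /m; case: (leP mu) => _.
rewrite edist_infE => /ereal_inf_lt[_ [y0 Fy0 <-]]; rewrite distrC => y0m.
have [a [mu1 [/andP[a0 aal] ymu mum]]] :=
  exists_slope_radius (normr_ge0 _) al0 y0m.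
rewrite le_min in mum; move/andP: mum => [mu1mu mu1pre].
have mu10 : 0 < mu1 by have := le_lt_trans (normr_ge0 _) ymu; rewrite pmulr_rgt0.
pose a' := (a + alpha) / 2.
exists a', mu1; split; first by apply/andP; rewrite /a'; split; lra.
  move=> u y ux yy; split.
  - rewrite /eball/=; apply: (@le_lt_trans _ _ (`|x - xbar|%:E + `|u - x|%:E)%E).
      by rewrite -EFinD lee_fin; have := ler_distD x u xbar; lra.
    by apply: lteD => //; apply: lt_le_trans mu1mu; rewrite lte_fin.
  - move=> Pu; have : (edist_inf (preimg Phi ybar) x <= `|x - u|%:E)%E.
      by rewrite edist_infE; apply: ereal_inf_lbound; exists u.
    move=> /(le_trans mu1pre); rewrite lee_fin distrC; lra.
  - rewrite /eball/=; apply: (@lt_le_trans _ _ (alpha * mu1)%:E).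
      by rewrite lte_fin.
    by rewrite EFinM lee_pmul2l// lte_fin.
move=> g g0.
have phic : continuous (fun z : X * Y => `|z.2 - ybar|).
  apply: (@lipschitz_continuous _ _ _ 1) => u v; rewrite mul1r.
  have [_ n2] := prod_norm_ge (u - v); apply: le_trans n2.
  by have := ler_distD v.2 u.2 ybar; rewrite /=; lra.
have k0 : 0 < (alpha - a) / 2 by rewrite divr_gt0// subr_gt0.
(* Half the slack as Ekeland error keeps the total value below [a * mu1], which bounds both the
   distance to x and the residual. *)
have s0 : 0 < (a * mu1 - `|y0 - ybar|) / 2 by rewrite divr_gt0// subr_gt0.
have [|z [zP zle zmin]] := @ekeland_variational_principle R _
    (weighted_norm g) _ (gph Phi) _ (x, y0) a _ _
    (@prod_complete R X Y) (weighted_const_gt0 g0) (weighted_normD g0)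
    (@weighted_normN _ _ _ g) (weighted_norm_le g0) (weighted_norm_ge g0)
    Pc Fy0 phic _ (ltW a0) k0 s0; first by [].
have zlt : `|z.2 - ybar| + a * weighted_norm g (z - (x, y0)) < a * mu1.
  by apply: le_lt_trans zle _ => /=; lra.
have N0 : 0 <= weighted_norm g (z - (x, y0)).
  by rewrite addr_ge0// mulr_ge0// ltW.
exists z; split=> //.
- have : weighted_norm g (z - (x, y0)) < mu1.
    rewrite -(ltr_pM2l a0); apply: le_lt_trans zlt.
    by rewrite lerDr.
  apply: le_lt_trans; rewrite /weighted_norm/= lerDl mulr_ge0// ltW//.
- apply: (@lt_trans _ _ (a * mu1)); last by rewrite ltr_pM2r.
  by apply: le_lt_trans zlt; rewrite lerDl mulr_ge0// ltW.
- move=> v Pv; apply: le_trans (zmin v Pv) _.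
  by have -> : a + (alpha - a) / 2 = a' by rewrite /a'; field.
Qed.

End SubregularityViolation.

(** In either case a multiplier [xs] of norm below alpha appears in the coderivative image of an
    eta-ball around a unit functional, against the assumed estimate. *)
Theorem corollary4p8 (R : realType) (P : Type) (X Y : completeNormedModType R)
    (F : P -> X -> set Y) (xbar : X) (ybar : Y)
    (alpha : R) (delta mu : \bar R)
    (hP : inhabited P)
    (hF : forall p : P, closed (gph (F p)))
    (halpha : 0 < alpha) (hdelta : (0 < delta)%E) (hmu : (0 < mu)%E)
    (hcond : exists2 eta : \bar R, (0 < eta)%E & forall p : P,
       (forall (x : X) (y : Y),
          eball xbar (delta + mu)%E x -> ~ preimg (F p) ybar x ->
          F p x y -> eball ybar (alpha%:E * mu)%E y ->
          forall ystar : Y -> R, dual ystar ->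
            dual_norm ystar = 1%E ->
            ystar (y - ybar) = `|y - ybar| ->
            (alpha%:E <= dual_dist0
               (coderivative_image (@clarke_normal R _) (F p) x y
                  (dual_ball ystar eta)))%E)
       \/
       (asplund X /\ asplund Y /\
        exists2 tau : R, 0 < tau < 1 &
        forall (x : X) (y : Y),
          eball xbar (delta + mu)%E x -> ~ preimg (F p) ybar x ->
          F p x y -> eball ybar (alpha%:E * mu)%E y ->
          forall ystar : Y -> R, dual ystar ->
            dual_norm ystar = 1%E ->
            ystar (y - ybar) > tau * `|y - ybar| ->
            (alpha%:E <= dual_dist0
               (coderivative_image (@frechet_normal R _) (F p) x y
                  (dual_ball ystar eta)))%E)) :
  uniformly_subregular F alpha xbar ybar delta mu.
Proof.
have [eta eta0 hp] := hcond; move=> p x xd xmu.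
rewrite leNgt; apply/negP => viol.
have [a [mu1 [/andP[a0 aal] region points]]] :=
  violation_ekeland_points (hF p) halpha xd xmu viol.
have [e e0 eeta] : exists2 e : R, 0 < e & (e%:E <= eta)%E.
  by case: (eta) eta0 => [r| |]// r0; [exists r|exists 1 => //; exact: leey].
have small (N : set (X * Y) -> X * Y -> set (X * Y -> R)) u y ystar vs xs (b : R) :
    b < alpha -> 0 <= b -> dual xs -> (forall w, `|xs w| <= b * `|w|) ->
    dual_ball ystar eta vs -> N (gph (F p)) (u, y) (fun z => xs z.1 - vs z.2) ->
    ~ (alpha%:E <= dual_dist0
        (coderivative_image N (F p) u y (dual_ball ystar eta)))%E.
  move=> bal b0 xsd xsb vsb Nxs; apply/negP; rewrite -ltNge.
  apply: (@le_lt_trans _ _ (dual_norm xs)).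
    by apply: ereal_inf_lbound; exists xs => //; exists vs.
  by apply: le_lt_trans (dual_norm_le b0 xsb) _; rewrite lte_fin.
have [clarke|[aX [aY [tau /andP[tau0 tau1] frechet]]]] := hp p.
(* This g gives [a * g = e / 2], so [zs] moves [ystar] by less than eta. *)
- have g0 : 0 < e / (2 * a) by rewrite divr_gt0// mulr_gt0.
  have [[u y] [/= Fuy ux yy zmin]] := points _ g0.
  have [ud upre yd] := region u y ux yy.
  have y0 : y != ybar by apply/eqP => yE; apply: upre; rewrite /preimg/= -yE.
  have [ystar [zs [xs [[yl zl xl] [y1 yE zb xb] nor]]]] :=
    clarke_multiplier Fuy y0 (ltW a0) g0 zmin.
  have y1' v : `|ystar v| <= 1 * `|v| by rewrite mul1r.
  have ysd : dual ystar := bounded_dual yl y1'.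
  have ys1 : dual_norm ystar = 1%E.
    apply/le_anti/andP; split; first exact: dual_norm_le.
    by apply: (@dual_norm_ge _ _ _ (y - ybar)); rewrite ?subr_eq0// mul1r yE.
  have ag : a * (e / (2 * a)) = e / 2 by field; rewrite gt_eqF.
  apply: (small (@clarke_normal R _) u y ystar (fun v => ystar v + zs v) xs a) => //.
  + exact: ltW.
  + exact: bounded_dual xb.
  + split.
      apply: (@bounded_dual _ _ _ (1 + e / 2)) => [b v w|v].
        by rewrite yl zl /GRing.scale/=; ring.
      by have := ler_normD (ystar v) (zs v); have := y1 v; have := zb v;
        rewrite ag; clear; lra.
    apply: (@le_lt_trans _ _ (e / 2)%:E).
      apply: dual_norm_le => [|v]; first by rewrite divr_ge0// ltW.
      by rewrite /= addrC addKr -ag.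
    by apply: lt_le_trans eeta; rewrite lte_fin; clear -e0; lra.
  + exact: clarke.
(* The bound e / 2 keeps the normalized functional within eta; the bound (1 - tau) / 4 makes
   [(1 - s) / (1 + s)] exceed tau. *)
- pose s := Num.min (e / 2) ((1 - tau) / 4).
  have s0 : 0 < s by rewrite lt_min; clear -e0 tau1; apply/andP; split; lra.
  have se : s <= e / 2 by rewrite ge_min lexx.
  have stau : s <= (1 - tau) / 4 by rewrite ge_min lexx orbT.
  clearbody s.
  (* The first bound keeps a + k below alpha; the second, with [(a + k) * g = s / 2], makes
     [1 - k - (a + k) * g] at least 1 - s. *)
  pose k := Num.min ((alpha - a) / 2) (s / 2).
  have k0 : 0 < k by rewrite lt_min; clear -aal s0; apply/andP; split; lra.
  have ka : k <= (alpha - a) / 2 by rewrite ge_min lexx.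
  have ks : k <= s / 2 by rewrite ge_min lexx orbT.
  clearbody k.
  have g0 : 0 < s / (2 * (a + k)) by rewrite divr_gt0// mulr_gt0// addr_gt0.
  have ag : (a + k) * (s / (2 * (a + k))) = s / 2.
    by field; rewrite gt_eqF// addr_gt0.
  have [[u y] [/= Fuy ux yy zmin]] := points _ g0.
  have [_ upre _] := region u y ux yy.
  have y0 : y != ybar by apply/eqP => yE; apply: upre; rewrite /preimg/= -yE.
  (* Half the slack in both strict inequalities keeps the fuzzy point in the region. *)
  pose r := Num.min (mu1 - `|u - x|) (alpha * mu1 - `|y - ybar|) / 2.
  have r0 : 0 < r.
    by rewrite divr_gt0// lt_min; apply/andP; split; rewrite subr_gt0.
  have [[u1 y1] [xs [vs [[Fu1 zr] [xl vl] [xb vb] vy nor]]]] :=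
    fuzzy_multiplier aX aY (hF p) Fuy y0 (ltW a0) g0 k0 r0 zmin.
  rewrite /= ag in vb vy.
  have [n1 n2] := prod_norm_ge ((u1, y1) - (u, y)).
  have r1 : 2 * r <= mu1 - `|u - x|.
    by rewrite /r mulrC divfK// ge_min lexx.
  have r2 : 2 * r <= alpha * mu1 - `|y - ybar|.
    by rewrite /r mulrC divfK// ge_min lexx orbT.
  clearbody r.
  have [|| u1d u1pre y1d] := region u1 y1.
  + by have := ler_distD u u1 x; have := le_trans n1 zr; clear -r0 r1; rewrite /=; lra.
  + by have := ler_distD y y1 ybar; have := le_trans n2 zr; clear -r0 r2;
      rewrite /=; lra.
  have y10 : y1 - ybar != 0.
    by rewrite subr_eq0; apply/eqP => yE; apply: u1pre; rewrite /preimg/= -yE.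
  have ny1 : 0 < `|y1 - ybar| by rewrite normr_gt0.
  have [|||ystar [ysd ys1 ysy vys]] :=
    @dual_normalize _ _ vs 0 s (y1 - ybar) vl _ y10.
  + by clear -s0 stau tau0; apply/andP; split; lra.
  + move=> w; apply: le_trans (vb w) _; rewrite ler_wpM2r//; clear -s0; lra.
  + by apply: le_trans vy; rewrite ler_wpM2r//; clear -ks; lra.
  apply: (small (@frechet_normal R _) u1 y1 ystar vs xs (a + k)) => //.
  + by clear -ka aal; lra.
  + by rewrite addr_ge0// ltW.
  + exact: bounded_dual xb.
  + split; first exact: bounded_dual vb.
    apply: le_lt_trans vys _; apply: lt_le_trans eeta; rewrite lte_fin; clear -se e0; lra.
  + apply: frechet => //; apply: lt_le_trans ysy.
    rewrite ltr_pM2r// ltr_pdivlMr ?addr_gt0//; clear -s0 stau tau0 tau1; nra.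
Qed.
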